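(* Let $\mathcal{C}$, $G$, $H$, $\alpha$, $H_1$ be as described in the context, and suppose that $H$ acts transitively on $\mathcal{C}(x,y)$. If $k\mathcal{C}$ is of finite representation type, then the following conditions must be satisfied: (1) $\dim_k \operatorname{End}_{kH}(k\uparrow_{H_1}^H)=|H_1\backslash H/H_1|\leqslant 3$; (2) the simple summands of $\operatorname{Top}(k\uparrow_{H_1}^H)$ are pairwise non-isomorphic (no simple module occurs more than once); (3) if $M\ncong N$ are indecomposable direct summands of $k\uparrow_{H_1}^H$, then $\operatorname{Hom}_{kH}(M,N)=0$.
   Context: $k$ is an algebraically closed field of characteristic $p\geqslant 0$. A finite EI category is a small category with finitely many morphisms in which every endomorphism is an isomorphism. Its category algebra $k\mathcal{C}$ is the $k$-algebra with basis the set of all morphisms, the product of two morphisms being their composite (composed from right to left) if it exists and $0$ otherwise. $k\mathcal{C}$ is of finite representation type if it has only finitely many isomorphism classes of finitely generated indecomposable left modules. $\mathcal{C}$ is a connected skeletal finite EI category with exactly two objects $x,y$, with $\mathcal{C}(x,y)\neq\emptyset$ and $\mathcal{C}(y,x)=\emptyset$; here $\mathcal{C}(x,y)$ is the set of morphisms from $x$ to $y$. Put $G=\mathcal{C}(x,x)$ and $H=\mathcal{C}(y,y)$; $G$ acts on $\mathcal{C}(x,y)$ on the right and $H$ on the left by composition. $\mathcal{C}(x,y)$ is a single orbit as an $(H,G)$-biset, and $\alpha\in\mathcal{C}(x,y)$ is a fixed morphism. Define $H_1=\operatorname{Stab}_H(\alpha G)=\{h\in H: h\alpha G=\alpha G\}$.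 $k\uparrow_{H_1}^H=kH\otimes_{kH_1}k$ is the module induced from the trivial $kH_1$-module $k$; $H_1\backslash H/H_1$ is the set of double cosets; $\operatorname{Top}(M)=M/\operatorname{rad}M$. *)

(* Defs.v *)
From HB Require Import structures.
From mathcomp Require Import all_boot all_order all_algebra all_fingroup.
From mathcomp Require Import generic_quotient ring_quotient.
From mathcomp Require Import boolp.

Set Implicit Arguments.
Unset Strict Implicit.
Unset Printing Implicit Defensive.

Import GRing.Theory.

Local Open Scope ring_scope.
Local Open Scope quotient_scope.

(* Identities make the objects of a category with finitely many morphisms
   finitely many, hence [ob : finType]. *)
Record finCat := FinCat {
  ob :> finType;
  homset : ob -> ob -> finType;
  idm : forall a, homset a a;
  compose : forall a b c, homset b c -> homset a b -> homset a c;
  composeA : forall a b c d (f : homset c d) (g : homset b c) (h : homset a b),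
    compose f (compose g h) = compose (compose f g) h;
  compose1m : forall a b (f : homset a b), compose (idm b) f = f;
  composem1 : forall a b (f : homset a b), compose f (idm a) = f }.

Arguments homset {f} a b : rename.
Arguments idm {f} a : rename.
Arguments compose {f a b c} _ _ : rename.

Definition isomorphism (C : finCat) (a b : C) (f : homset a b) : Prop :=
  exists g : homset b a, compose g f = idm a /\ compose f g = idm b.

Record finEICat := FinEICat {
  EI_cat :> finCat;
  EI_endo : forall (a : EI_cat) (f : homset a a), isomorphism f }.

Definition skeletal_cat (C : finCat) : Prop :=
  forall (a b : C) (f : homset a b), isomorphism f -> a = b.

Definition connected_cat (C : finCat) : Prop :=
  forall a b : C,
    connect (fun c d : C => (0 < #|homset c d|) || (0 < #|homset d c|))%N a b.

(* The group of endomorphisms of an object, with product [g * h] the composite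
   "first [h], then [g]". *)
Definition endgrp (C : finEICat) (a : C) : Type := homset a a.

Section EndGroup.
Variables (C : finEICat) (a : C).

Lemma endgrp_inv_ex (f : homset a a) :
  exists g : homset a a, compose g f == idm a.
Proof. by have [g [gf _]] := EI_endo f; exists g; apply/eqP. Qed.

Definition endgrp_inv (f : homset a a) : homset a a :=
  xchoose (endgrp_inv_ex f).

Lemma endgrp_mulVg : left_inverse (idm a) endgrp_inv (@compose C a a a).
Proof. by move=> f; apply/eqP/(xchooseP (endgrp_inv_ex f)). Qed.

HB.instance Definition _ := Finite.copy (endgrp a) (homset a a).
HB.instance Definition _ := Finite_isGroup.Build (endgrp a)
  (fun f g h => composeA f g h) (fun f => compose1m f) endgrp_mulVg.
End EndGroup.

Section Orbits.
Variables (C : finEICat) (x y : C).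

(* [alpha G] *)
Definition rorbit (alpha : homset x y) : {set homset x y} :=
  [set compose alpha g | g : endgrp x].

(* [h B] for [B] a set of morphisms from [x] to [y] *)
Definition ltranslate (h : endgrp y) (B : {set homset x y}) :
    {set homset x y} :=
  [set compose h b | b in B].

Definition rorbit_stab (alpha : homset x y) : {set endgrp y} :=
  [set h | ltranslate h (rorbit alpha) == rorbit alpha].

Lemma rorbit_stab_group_set alpha : group_set (rorbit_stab alpha).
Proof.
apply/group_setP; split=> [|g h].
  rewrite inE; apply/eqP; rewrite -[RHS]imset_id; apply: eq_imset => b.
  exact: compose1m.
rewrite !inE => /eqP gS /eqP hS; apply/eqP; rewrite -{2}gS -{2}hS /ltranslate.
by rewrite -imset_comp; apply: eq_imset => b /=; rewrite composeA.
Qed.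

Canonical rorbit_stab_group alpha := Group (rorbit_stab_group_set alpha).

Definition single_biorbit : Prop :=
  forall b b' : homset x y,
    exists (h : endgrp y) (g : endgrp x), b' = compose (compose h b) g.

Definition ltransitive : Prop :=
  forall b b' : homset x y, exists h : endgrp y, b' = compose h b.

End Orbits.

(* [A \ gT / A] *)
Definition double_cosets (gT : finGroupType) (A : {set gT}) : {set {set gT}} :=
  [set ((A :* g) * A)%g | g : gT].

Section CategoryAlgebra.
Variables (k : fieldType) (C : finCat).

Definition mor := {d : C * C & homset d.1 d.2}.

Definition to_mor (a b : C) (f : homset a b) : mor :=
  Tagged (fun d : C * C => homset d.1 d.2) (i := (a, b)) f.

(* A function [u] stands for the combination of the [u f], [f] a morphism. *)
Definition catalg : Type := {ffun mor -> k}.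

HB.instance Definition _ := GRing.Lmodule.copy catalg {ffun mor -> k^o}.

Definition catalg_coef (u : catalg) (a b : C) (f : homset a b) : k :=
  u (to_mor f).

Definition catalg_basis (m : mor) : catalg := [ffun n => (n == m)%:R].

Definition catalg_mul (u v : catalg) : catalg :=
  [ffun m : mor =>
     \sum_(b : C) \sum_(f : homset b (tag m).2) \sum_(g : homset (tag m).1 b)
        catalg_coef u f * catalg_coef v g * (compose f g == tagged m)%:R].

Definition catalg_one : catalg := \sum_(a : C) catalg_basis (to_mor (idm a)).

Lemma catalg_eqP (u v : catalg) :
  (forall (a b : C) (f : homset a b), catalg_coef u f = catalg_coef v f) ->
  u = v.
Proof. by move=> uv; apply/ffunP => -[[a b] f]; apply: uv. Qed.

Lemma catalg_coefM u v a d (h : homset a d) :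
  catalg_coef (catalg_mul u v) h =
  \sum_(b : C) \sum_(f : homset b d) \sum_(g : homset a b)
     catalg_coef u f * catalg_coef v g * (compose f g == h)%:R.
Proof. by rewrite /catalg_coef ffunE. Qed.

Lemma catalg_coefD u v a b (f : homset a b) :
  catalg_coef (u + v) f = catalg_coef u f + catalg_coef v f.
Proof. by rewrite /catalg_coef ffunE. Qed.

Lemma to_mor_inj a b : injective (@to_mor a b).
Proof. by move=> f g /eqP; rewrite /to_mor eq_Tagged => /eqP. Qed.

Lemma catalg_coef1 a b (f : homset a b) :
  catalg_coef catalg_one f = (to_mor f == to_mor (idm a))%:R.
Proof.
rewrite /catalg_coef /catalg_one sum_ffunE (bigD1 a) //= ffunE big1 ?addr0 //.
move=> c ca; rewrite ffunE; case: eqP => // /(congr1 (fun m => (tag m).1)) /= e.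
by rewrite -e eqxx in ca.
Qed.

Lemma catalg_mulA : associative catalg_mul.
Proof.
move=> u v w; apply: catalg_eqP => a d h; rewrite !catalg_coefM.
transitivity (\sum_(b : C) \sum_(c : C) \sum_(f : homset b d) \sum_(g : homset c b)
   \sum_(l : homset a c) catalg_coef u f * catalg_coef v g * catalg_coef w l
      * (compose f (compose g l) == h)%:R).
  apply: eq_bigr => b _; rewrite [RHS]exchange_big; apply: eq_bigr => f _ /=.
  under eq_bigr => g _ do rewrite catalg_coefM mulr_sumr mulr_suml.
  rewrite exchange_big; apply: eq_bigr => c _ /=.
  under eq_bigr => g _ do rewrite mulr_sumr mulr_suml.
  rewrite exchange_big; apply: eq_bigr => g _ /=.
  under eq_bigr => l _ do rewrite mulr_sumr mulr_suml.
  rewrite exchange_big; apply: eq_bigr => l _ /=.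
  rewrite (bigD1 (compose g l)) //= eqxx mulr1 mulrA big1 ?addr0 // => i.
  by rewrite eq_sym => /negbTE->; rewrite !mulr0 mul0r.
rewrite exchange_big; apply: eq_bigr => c _ /=; symmetry.
transitivity (\sum_(l : homset a c) \sum_(b : C) \sum_(f : homset b d)
   \sum_(g : homset c b) catalg_coef u f * catalg_coef v g * catalg_coef w l
      * (compose f (compose g l) == h)%:R); last first.
  rewrite exchange_big; apply: eq_bigr => b _ /=.
  rewrite exchange_big; apply: eq_bigr => f _ /=.
  by rewrite exchange_big.
rewrite exchange_big; apply: eq_bigr => l _ /=.
under eq_bigr => f _ do rewrite catalg_coefM !mulr_suml.
rewrite exchange_big; apply: eq_bigr => b _ /=.
under eq_bigr => g _ do rewrite !mulr_suml.
rewrite exchange_big; apply: eq_bigr => f _ /=.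
under eq_bigr => g _ do rewrite !mulr_suml.
rewrite exchange_big; apply: eq_bigr => g _ /=.
rewrite (bigD1 (compose f g)) //= eqxx mulr1 composeA big1 ?addr0 // => i.
by rewrite eq_sym => /negbTE->; rewrite mulr0 !mul0r.
Qed.

Lemma catalg_mul1r : left_id catalg_one catalg_mul.
Proof.
move=> u; apply: catalg_eqP => a d h; rewrite catalg_coefM (bigD1 d) //=.
rewrite (bigD1 (idm d)) //= (bigD1 h) //= compose1m eqxx catalg_coef1 eqxx.
rewrite mulr1 mul1r !big1 ?addr0 //.
- move=> b bd; apply: big1 => f _; apply: big1 => g _; rewrite catalg_coef1.
  case: eqP => [/(congr1 (fun m => (tag m).2)) /= e|_].
    by rewrite e eqxx in bd.
  by rewrite !mul0r.
- move=> f fd; apply: big1 => g _; rewrite catalg_coef1.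
  by rewrite (inj_eq (@to_mor_inj _ _)) (negbTE fd) !mul0r.
- by move=> g gh; rewrite compose1m (negbTE gh) mulr0.
Qed.

Lemma catalg_mulr1 : right_id catalg_one catalg_mul.
Proof.
move=> u; apply: catalg_eqP => a d h; rewrite catalg_coefM (bigD1 a) //=.
rewrite (bigD1 h) //= (bigD1 (idm a)) //= composem1 eqxx catalg_coef1 eqxx.
rewrite !mulr1 !big1 ?addr0 //.
- move=> b bd; apply: big1 => f _; apply: big1 => g _; rewrite catalg_coef1.
  case: eqP => [/(congr1 (fun m => (tag m).2)) /= e|_].
    by rewrite e eqxx in bd.
  by rewrite mulr0 mul0r.
- move=> f fd; apply: big1 => g _; rewrite catalg_coef1.
  rewrite (inj_eq (@to_mor_inj _ _)); case: eqP => [->|]; last by rewrite mulr0 mul0r.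
  by rewrite composem1 (negbTE fd) !mulr0.
- move=> g gh; rewrite catalg_coef1 (inj_eq (@to_mor_inj _ _)) (negbTE gh).
  by rewrite mulr0 mul0r.
Qed.

Lemma catalg_mulDl : left_distributive catalg_mul +%R.
Proof.
move=> u v w; apply: catalg_eqP => a d h; rewrite catalg_coefD !catalg_coefM.
rewrite -big_split; apply: eq_bigr => b _; rewrite -big_split.
apply: eq_bigr => f _; rewrite -big_split; apply: eq_bigr => g _ /=.
by rewrite catalg_coefD !mulrDl.
Qed.

Lemma catalg_mulDr : right_distributive catalg_mul +%R.
Proof.
move=> u v w; apply: catalg_eqP => a d h; rewrite catalg_coefD !catalg_coefM.
rewrite -big_split; apply: eq_bigr => b _; rewrite -big_split.
apply: eq_bigr => f _; rewrite -big_split; apply: eq_bigr => g _ /=.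
by rewrite catalg_coefD mulrDr mulrDl.
Qed.

HB.instance Definition _ := GRing.Zmodule_isPzRing.Build catalg
  catalg_mulA catalg_mul1r catalg_mulr1 catalg_mulDl catalg_mulDr.

Lemma catalg_coef_basis (m : mor) a b (f : homset a b) :
  catalg_coef (catalg_basis m) f = (to_mor f == m)%:R.
Proof. by rewrite /catalg_coef ffunE. Qed.

Lemma catalg_basisM a b c (f : homset b c) (g : homset a b) :
  catalg_basis (to_mor f) * catalg_basis (to_mor g)
  = catalg_basis (to_mor (compose f g)).
Proof.
apply/ffunP => -[[a' c'] h].
rewrite -[LHS]/(catalg_coef (catalg_mul _ _) h).
rewrite -[RHS]/(catalg_coef _ h) catalg_coefM catalg_coef_basis.
have [e|ne] := eqVneq (a', c') (a, c); last first.
  rewrite big1 => [|b' _].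
    case: eqP => // /(congr1 (@tag _ _)) /= e; by rewrite e eqxx in ne.
  apply: big1 => f' _; apply: big1 => g' _; rewrite !catalg_coef_basis.
  case: eqP => [/(congr1 (fun m => (tag m).2)) /= e1|_]; last by rewrite !mul0r.
  case: eqP => [/(congr1 (fun m => (tag m).1)) /= e2|_]; last by rewrite mulr0 mul0r.
  by rewrite e1 e2 eqxx in ne.
case: e h => -> -> h; rewrite (bigD1 b) //= (bigD1 f) //= (bigD1 g) //=.
rewrite !catalg_coef_basis !eqxx !mul1r (inj_eq (@to_mor_inj _ _)) [h == _]eq_sym.
rewrite !big1 ?addr0 //.
- move=> b' bb'; apply: big1 => f' _; apply: big1 => g' _.
  rewrite catalg_coef_basis.
  case: eqP => [/(congr1 (fun m => (tag m).1)) /= e1|_]; last by rewrite !mul0r.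
  by rewrite e1 eqxx in bb'.
- move=> f' ff'; apply: big1 => g' _; rewrite catalg_coef_basis.
  by rewrite (inj_eq (@to_mor_inj _ _)) (negbTE ff') !mul0r.
- move=> g' gg'; rewrite !catalg_coef_basis.
  by rewrite !(inj_eq (@to_mor_inj _ _)) (negbTE gg') mulr0 mul0r.
Qed.

Lemma catalg_basisM0 a b b' c (f : homset b c) (g : homset a b') :
  b != b' -> catalg_basis (to_mor f) * catalg_basis (to_mor g) = 0.
Proof.
move=> bb'; apply/ffunP => -[[a' c'] h].
rewrite -[LHS]/(catalg_coef (catalg_mul _ _) h) catalg_coefM ffunE.
apply: big1 => d _; apply: big1 => f' _; apply: big1 => g' _.
rewrite !catalg_coef_basis.
case: eqP => [/(congr1 (fun m => (tag m).1)) /= e1|_]; last by rewrite !mul0r.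
case: eqP => [/(congr1 (fun m => (tag m).2)) /= e2|_]; last by rewrite mulr0 mul0r.
by rewrite -e1 -e2 eqxx in bb'.
Qed.

End CategoryAlgebra.

(* The trivial module [k], on which every group element acts as identity. *)
Definition trivmod (k : fieldType) (gT : finGroupType) : Type := k.

Section GroupAlgebra.
Variables (k : fieldType) (gT : finGroupType).

(* A function [u] stands for the combination of the [u g], [g] in [gT]. *)
Definition grpalg : Type := {ffun gT -> k}.

HB.instance Definition _ := GRing.Lmodule.copy grpalg {ffun gT -> k^o}.

Definition grpalg_mul (u v : grpalg) : grpalg :=
  [ffun g => \sum_(h : gT) u h * v (h^-1 * g)%g].

Definition grpalg_one : grpalg := [ffun g => (g == 1%g)%:R].

Lemma grpalg_mulA : associative grpalg_mul.
Proof.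
move=> u v w; apply/ffunP => g; rewrite !ffunE.
under eq_bigr => h _ do rewrite ffunE mulr_sumr.
under [RHS]eq_bigr => h _ do rewrite ffunE mulr_suml.
rewrite [RHS]exchange_big; apply: eq_bigr => h _ /=.
rewrite [RHS](reindex_inj (mulgI h)) /=; apply: eq_bigr => l _.
by rewrite mulKg invMg !mulgA mulrA.
Qed.

Lemma grpalg_mul1r : left_id grpalg_one grpalg_mul.
Proof.
move=> u; apply/ffunP => g; rewrite ffunE (bigD1 1%g) //= ffunE eqxx.
rewrite mul1r invg1 mul1g big1 ?addr0 // => h /negbTE hn1.
by rewrite ffunE hn1 mul0r.
Qed.

Lemma grpalg_mulr1 : right_id grpalg_one grpalg_mul.
Proof.
move=> u; apply/ffunP => g; rewrite ffunE (bigD1 g) //= ffunE mulVg eqxx.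
rewrite mulr1 big1 ?addr0 // => h hg.
by rewrite ffunE -eq_mulVg1 (negbTE hg) mulr0.
Qed.

Lemma grpalg_mulDl : left_distributive grpalg_mul +%R.
Proof.
move=> u v w; apply/ffunP => g; rewrite !ffunE -big_split.
by apply: eq_bigr => h _; rewrite ffunE mulrDl.
Qed.

Lemma grpalg_mulDr : right_distributive grpalg_mul +%R.
Proof.
move=> u v w; apply/ffunP => g; rewrite !ffunE -big_split.
by apply: eq_bigr => h _; rewrite ffunE mulrDr.
Qed.

Lemma grpalg_one_neq0 : grpalg_one != 0.
Proof.
apply/eqP => /ffunP/(_ 1%g); rewrite !ffunE eqxx => /eqP.
by rewrite oner_eq0.
Qed.

HB.instance Definition _ := GRing.Zmodule_isNzRing.Build grpalg
  grpalg_mulA grpalg_mul1r grpalg_mulr1 grpalg_mulDl grpalg_mulDr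
  grpalg_one_neq0.

Lemma grpalg_scalerAl (c : k) (u v : grpalg) : c *: (u * v) = (c *: u) * v.
Proof.
apply/ffunP => g; rewrite !ffunE /= scaler_sumr; apply: eq_bigr => h _.
by rewrite ffunE -mulrA.
Qed.

HB.instance Definition _ :=
  GRing.Lmodule_isLalgebra.Build k grpalg grpalg_scalerAl.

Definition augmentation (u : grpalg) : k := \sum_(g : gT) u g.

Lemma augmentation_is_nmod_morphism : nmod_morphism augmentation.
Proof.
split=> [|u v]; first by apply: big1 => g _; rewrite ffunE.
by rewrite /augmentation -big_split; apply: eq_bigr => g _; rewrite ffunE.
Qed.

Lemma augmentation_is_monoid_morphism : monoid_morphism augmentation.
Proof.
split=> [|u v].
  rewrite /augmentation (bigD1 1%g) //= ffunE eqxx big1 ?addr0 // => g.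
  by move=> /negbTE gn1; rewrite ffunE gn1.
rewrite /augmentation; under eq_bigr => g _ do rewrite ffunE.
rewrite exchange_big mulr_suml; apply: eq_bigr => h _ /=.
rewrite -mulr_sumr; congr (_ * _); rewrite (reindex_inj (mulgI h)) /=.
by apply: eq_bigr => g _; rewrite mulKg.
Qed.

HB.instance Definition _ :=
  GRing.isNmodMorphism.Build grpalg k augmentation augmentation_is_nmod_morphism.
HB.instance Definition _ :=
  GRing.isMonoidMorphism.Build grpalg k augmentation augmentation_is_monoid_morphism.

Local Notation trivmod := (trivmod k gT).

HB.instance Definition _ := GRing.Zmodule.copy trivmod k.

Definition trivmod_scale (u : grpalg) (c : trivmod) : trivmod :=
  augmentation u * (c : k).

Fact trivmod_scalerA u v c :
  trivmod_scale u (trivmod_scale v c) = trivmod_scale (u * v) c.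
Proof. by rewrite /trivmod_scale rmorphM mulrA. Qed.

Fact trivmod_scale1r : left_id 1 trivmod_scale.
Proof. by move=> c; rewrite /trivmod_scale rmorph1 mul1r. Qed.

Fact trivmod_scalerDr : right_distributive trivmod_scale +%R.
Proof. by move=> u c d; apply: mulrDr. Qed.

Fact trivmod_scalerDl c : {morph trivmod_scale^~ c : u v / u + v}.
Proof. by move=> u v; rewrite /trivmod_scale raddfD; apply: mulrDl. Qed.

HB.instance Definition _ := GRing.Zmodule_isLmodule.Build grpalg trivmod
  trivmod_scalerA trivmod_scale1r trivmod_scalerDr trivmod_scalerDl.

End GroupAlgebra.

Section SubgroupAlgebra.
Variables (k : fieldType) (gT : finGroupType) (H : {group gT}).

(* The inclusion of the algebra of [H] in that of [gT]. *)
Definition grpalg_incl (u : grpalg k (subg_of H)) : grpalg k gT :=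
  [ffun g => \sum_(s : subg_of H | sgval s == g) u s].

Lemma grpalg_incl_is_nmod_morphism : nmod_morphism grpalg_incl.
Proof.
split=> [|u v]; apply/ffunP => g; rewrite !ffunE.
  by apply: big1 => s _; rewrite ffunE.
by rewrite -big_split; apply: eq_bigr => s _; rewrite ffunE.
Qed.

Lemma grpalg_incl_is_monoid_morphism : monoid_morphism grpalg_incl.
Proof.
split=> [|u v]; apply/ffunP => g; rewrite !ffunE.
  have [->|gn1] := eqVneq g 1%g.
    rewrite (bigD1 1%g) //= ffunE eqxx big1 ?addr0 // => s /andP[_ /negbTE sn1].
    by rewrite ffunE sn1.
  rewrite big1 // => s /eqP sg; rewrite ffunE; case: eqP => // s1.
  by rewrite -sg s1 eqxx in gn1.
under eq_bigr => s _ do rewrite ffunE.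
rewrite exchange_big /=.
rewrite (partition_big (@sgval _ H) xpredT) //=.
apply: eq_bigr => h _; rewrite !ffunE mulr_suml; apply: eq_bigr => t /eqP th.
rewrite mulr_sumr (reindex_inj (mulgI t)) /=.
apply: eq_big => [s|s _]; last by rewrite mulKg.
by rewrite -th -(inj_eq (mulgI (sgval t)) (sgval s)) mulKVg.
Qed.

HB.instance Definition _ := GRing.isNmodMorphism.Build
  (grpalg k (subg_of H)) (grpalg k gT) grpalg_incl grpalg_incl_is_nmod_morphism.
HB.instance Definition _ := GRing.isMonoidMorphism.Build
  (grpalg k (subg_of H)) (grpalg k gT) grpalg_incl
  grpalg_incl_is_monoid_morphism.

End SubgroupAlgebra.

Arguments grpalg_incl {k gT} H u.

Section Modules.
Variable A : pzRingType.
Implicit Types M N : lmodType A.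

Definition isomorphic M N : Prop := exists f : {linear M -> N}, bijective f.

Definition finitely_generated M : Prop :=
  exists (n : nat) (e : 'I_n -> M),
    forall m : M, exists a : 'I_n -> A, m = \sum_(i < n) a i *: e i.

Definition nontrivial M : Prop := exists m : M, m != 0.

Definition complementary M (S T : submodClosed M) : Prop :=
  (forall m, exists s t, [/\ s \in S, t \in T & m = s + t]) /\
  (forall m, m \in S -> m \in T -> m = 0).

Definition direct_summand M (S : submodClosed M) : Prop :=
  exists T : submodClosed M, complementary S T.

Definition indecomposable M : Prop :=
  nontrivial M /\
  forall S T : submodClosed M, complementary S T ->
    (forall m, m \in S -> m = 0) \/ (forall m, m \in T -> m = 0).

Definition simple_module M : Prop :=
  nontrivial M /\
  forall S : submodClosed M,
    (forall m, m \in S -> m = 0) \/ (forall m, m \in S).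

Definition maximal_submodule M (S : submodClosed M) : Prop :=
  ~ (forall m, m \in S) /\
  forall T : submodClosed M, {subset S <= T} ->
    {subset T <= S} \/ (forall m, m \in T).

Definition direct_sum M n (S : 'I_n -> submodClosed M) : Prop :=
  forall m : M, exists! s : {ffun 'I_n -> M},
    (forall i, s i \in S i) /\ m = \sum_(i < n) s i.

Definition finite_representation_type : Prop :=
  exists (n : nat) (F : 'I_n -> lmodType A),
    forall M : lmodType A, finitely_generated M -> indecomposable M ->
      exists i : 'I_n, isomorphic M (F i).

End Modules.

Section Submodule.
Variables (A : pzRingType) (M : lmodType A) (S : submodClosed M).

Definition submodule : Type := {m : M | m \in S}.

HB.instance Definition _ := SubChoice.on submodule.
HB.instance Definition _ := [SubChoice_isSubLmodule of submodule by <:].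

End Submodule.

Section QuotientModule.
Variables (A : pzRingType) (M : lmodType A) (S : submodClosed M).

Definition submod_pred : {pred M} := fun m => m \in S.

Lemma submod_pred_zmod_closed : zmod_closed submod_pred.
Proof. exact: (GRing.submod_closedB (GRing.submodClosedP S)). Qed.

HB.instance Definition _ :=
  GRing.isZmodClosed.Build M submod_pred submod_pred_zmod_closed.

Definition quotmod : Type := Quotient.quot submod_pred.

HB.instance Definition _ := GRing.Zmodule.on quotmod.

Local Notation pi := (\pi_(Quotient.quot submod_pred)).

Definition quotmod_scale (a : A) (q : quotmod) : quotmod := pi (a *: repr q).

Lemma quotmod_pi_eqP (m n : M) : (pi m : quotmod) = pi n <-> m - n \in S.
Proof. by split=> [/eqP|mn]; [|apply/eqP]; rewrite -Quotient.idealrBE. Qed.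

Lemma quotmod_scale_pi a m : quotmod_scale a (pi m) = pi (a *: m).
Proof.
apply/quotmod_pi_eqP; rewrite -scalerBr rpredZ //.
by apply/quotmod_pi_eqP; rewrite reprK.
Qed.

Lemma quotmod_piD m n : (pi (m + n) : quotmod) = (pi m : quotmod) + pi n.
Proof. exact: Quotient.pi_add. Qed.

Fact quotmod_scalerA a b q :
  quotmod_scale a (quotmod_scale b q) = quotmod_scale (a * b) q.
Proof. by rewrite -[q]reprK (quotmod_scale_pi b) !quotmod_scale_pi scalerA. Qed.

Fact quotmod_scale1r : left_id 1 quotmod_scale.
Proof. by move=> q; rewrite -[q]reprK !quotmod_scale_pi scale1r. Qed.

Fact quotmod_scalerDr : right_distributive quotmod_scale +%R.
Proof.
move=> a q r; rewrite -[q]reprK -[r]reprK -quotmod_piD !quotmod_scale_pi.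
by rewrite scalerDr quotmod_piD.
Qed.

Fact quotmod_scalerDl q : {morph quotmod_scale^~ q : a b / a + b}.
Proof.
by move=> a b; rewrite -[q]reprK !quotmod_scale_pi scalerDl quotmod_piD.
Qed.

HB.instance Definition _ := GRing.Zmodule_isLmodule.Build A quotmod
  quotmod_scalerA quotmod_scale1r quotmod_scalerDr quotmod_scalerDl.

Definition quotmod_proj (m : M) : quotmod := pi m.

Lemma quotmod_proj_is_linear : linear quotmod_proj.
Proof.
by move=> a m n; rewrite /quotmod_proj quotmod_piD -quotmod_scale_pi.
Qed.

HB.instance Definition _ :=
  GRing.isLinear.Build A M quotmod _ quotmod_proj quotmod_proj_is_linear.

Lemma quotmod_proj_surj q : exists m, quotmod_proj m = q.
Proof. by exists (repr q); apply: reprK. Qed.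

Lemma quotmod_proj_ker m : quotmod_proj m = 0 <-> m \in S.
Proof.
rewrite -[0](raddf0 quotmod_proj).
by split=> [/quotmod_pi_eqP|mS]; [|apply/quotmod_pi_eqP]; rewrite subr0.
Qed.

End QuotientModule.

(* The intersection of the maximal submodules; [boolp.asbool] makes it a boolean
   predicate, hence a [submodClosed]. *)
Section Radical.
Variables (A : pzRingType) (M : lmodType A).

Definition radical : {pred M} :=
  [pred m | `[< forall S : submodClosed M, maximal_submodule S -> m \in S >]].

Lemma radical_submod_closed : submod_closed radical.
Proof.
split=> [|a m n /asboolP mR /asboolP nR]; apply/asboolP => S maxS.
  exact: rpred0.
by rewrite rpredD ?rpredZ ?mR ?nR.
Qed.

HB.instance Definition _ :=
  GRing.isSubmodClosed.Build A M radical radical_submod_closed.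

Definition Top : lmodType A := quotmod radical.

End Radical.

Definition simple_summands_distinct (A : pzRingType) (M : lmodType A) : Prop :=
  forall (n : nat) (S : 'I_n -> submodClosed M), direct_sum S ->
    forall i j : 'I_n, i != j ->
      simple_module (submodule (S i)) -> simple_module (submodule (S j)) ->
      ~ isomorphic (submodule (S i)) (submodule (S j)).

(* [Hom_A(M, N)] has dimension [d] over [k]: it has a [k]-basis with [d]
   elements.  (The scalars [c%:A] are to be central in [A], so that [c%:A *: f]
   is linear; this holds for group algebras.) *)
Definition hom_dim (k : fieldType) (A : lalgType k) (M N : lmodType A)
    (d : nat) : Prop :=
  exists e : 'I_d -> {linear M -> N}, forall f : {linear M -> N},
    exists! c : {ffun 'I_d -> k},
      forall m, f m = \sum_(i < d) (c i)%:A *: e i m.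

(* [A] is a right [B]-module through [iota : B -> A].  [T], with
   [t a n] for [a (x) n], is the left [A]-module [A (x)_B N]: [t] is the
   universal [B]-balanced map into an abelian group, and [A] acts on the left
   factor. *)
Section Tensor.
Variables (B A : pzRingType) (iota : {rmorphism B -> A}) (N : lmodType B).

Definition balanced (Z : zmodType) (f : A -> N -> Z) : Prop :=
  [/\ forall a a' n, f (a + a') n = f a n + f a' n,
      forall a n n', f a (n + n') = f a n + f a n'
    & forall a b n, f (a * iota b) n = f a (b *: n)].

Definition is_tensor (T : lmodType A) (t : A -> N -> T) : Prop :=
  [/\ balanced t,
      forall a a' n, t (a * a') n = a *: t a' n
    & forall (Z : zmodType) (f : A -> N -> Z), balanced f ->
        exists g : {additive T -> Z},
          (forall a n, g (t a n) = f a n) /\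
          forall g' : {additive T -> Z},
            (forall a n, g' (t a n) = f a n) -> g' =1 g].

End Tensor.

(* [V] is [kG (x)_{kH} k], the module induced from the trivial [kH]-module. *)
Definition induced_trivial (k : fieldType) (gT : finGroupType) (H : {group gT})
    (V : lmodType (grpalg k gT)) : Prop :=
  exists t : grpalg k gT -> trivmod k (subg_of H) -> V,
    is_tensor (grpalg_incl H) t.

(* Existence: the elements of [kG] constant on the left cosets of [H] form a
   model of the induced module. *)
Section InducedTrivialModel.
Variables (k : fieldType) (gT : finGroupType) (H : {group gT}).
Local Notation kG := (grpalg k gT).

Definition coset_constant : {pred kG^o} :=
  fun u : kG => [forall g, [forall h in H, u (g * h)%g == u g]].

Lemma coset_constantP (u : kG) :
  reflect (forall g h, h \in H -> u (g * h)%g = u g) (u \in coset_constant).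
Proof.
apply: (iffP forallP) => [uH g h hH|uH g].
  by have /forallP/(_ h) := uH g; rewrite hH => /eqP.
by apply/forall_inP => h hH; rewrite uH.
Qed.

Lemma coset_constant_submod_closed : submod_closed coset_constant.
Proof.
split=> [|a u v /coset_constantP uH /coset_constantP vH].
  by apply/coset_constantP => g h _; rewrite !ffunE.
apply/coset_constantP => g h hH; rewrite !ffunE vH //; congr (_ + _).
by apply: eq_bigr => l _; rewrite mulgA uH.
Qed.

HB.instance Definition _ :=
  GRing.isSubmodClosed.Build kG kG^o coset_constant coset_constant_submod_closed.

Local Notation W := (submodule coset_constant).

Definition const_on (c : k) : kG := [ffun g => if g \in H then c else 0].

Lemma const_on_coset_constant c : const_on c \in coset_constant.
Proof. by apply/coset_constantP => g h hH; rewrite !ffunE groupMr. Qed.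

Definition model_gen (c : k) : W := Sub (const_on c) (const_on_coset_constant c).

Definition model_tensor (a : kG) (c : trivmod k (subg_of H)) : W :=
  a *: model_gen c.

Lemma model_tensorE a c g : (val (model_tensor a c) : kG) g =
  \sum_(h in H) a (g * h)%g * (c : k).
Proof.
have -> : val (model_tensor a c) = (a : kG) * (const_on c) by [].
rewrite ffunE (reindex_inj (mulgI g)) /=.
rewrite [RHS]big_mkcond; apply: eq_bigr => h _; rewrite invMg ffunE.
by rewrite mulgKV groupV; case: ifP; rewrite ?mulr0.
Qed.

Lemma model_balanced : balanced (grpalg_incl H) model_tensor.
Proof.
split=> [a a' c|a c c'|a b c]; first exact: scalerDl.
  rewrite -scalerDr; congr (_ *: _); apply/val_inj/ffunP => g /=.
  by rewrite !ffunE; case: ifP; rewrite ?addr0.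
rewrite /model_tensor -scalerA; congr (_ *: _); apply/val_inj/ffunP => g.
transitivity (\sum_(h in H) grpalg_incl H b (g * h)%g * (c : k)).
  exact: model_tensorE.
rewrite -mulr_suml ffunE.
have E : \sum_(h in H) grpalg_incl H b (g * h)%g = 
         if g \in H then augmentation b else 0.
  under eq_bigr => h _ do rewrite ffunE.
  rewrite (exchange_big_dep xpredT) //= [in RHS]/augmentation.
  case: ifP => gH; last first.
    apply: big1 => s _; apply: big1 => h /andP[hH /eqP sE].
    by have := subgP s; rewrite sE groupMr // gH.
  apply: eq_bigr => s _; rewrite (big_pred1 (g^-1 * sgval s)%g) // => h /=.
  rewrite -[RHS](inj_eq (mulgI g)) mulKVg [RHS]eq_sym; case: eqP => [sE|]; rewrite ?andbF //.
  by rewrite andbT -(groupMl _ gH) -sE subgP.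
by rewrite E; case: ifP => _ //; rewrite mul0r.
Qed.

Definition is_repr (g : gT) := fingroup.repr (g *: H)%g == g.

Definition grp_basis (g : gT) : kG := [ffun h => (h == g)%:R].

Lemma grpalg_sum_basis (u : kG) : u = \sum_g u g *: grp_basis g.
Proof.
apply/ffunP => h; rewrite sum_ffunE (bigD1 h) //= !ffunE eqxx big1.
  by rewrite addr0 /GRing.scale /= mulr1.
by move=> g gh; rewrite !ffunE eq_sym (negbTE gh) /GRing.scale /= mulr0.
Qed.

Lemma sum_repr (Z : zmodType) (F : gT -> Z) :
  \sum_g F g = \sum_(g | is_repr g) \sum_(h in H) F (g * h)%g.
Proof.
have repr_in x : fingroup.repr (x *: H)%g \in (x *: H)%g.
  by rewrite (mem_repr x) // lcoset_refl.
have coset_repr x : (fingroup.repr (x *: H) *: H)%g = (x *: H)%g.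
  by apply/lcoset_eqP.
rewrite (partition_big (fun x => fingroup.repr (x *: H)%g) is_repr) /=; last first.
  by move=> x _; rewrite /is_repr coset_repr.
apply: eq_bigr => g /eqP gr; rewrite [LHS](reindex_inj (mulgI g)) /=.
apply: eq_bigl => h; apply/eqP/idP => [e|hH].
  have := coset_repr (g * h)%g; rewrite e => /lcoset_eqP.
  by rewrite mem_lcoset invMg mulgKV groupV.
by rewrite -{2}gr; congr fingroup.repr; apply/lcoset_eqP; rewrite mem_lcoset mulKg.
Qed.

Section UniversalMap.
Variables (Z : zmodType) (f : kG -> trivmod k (subg_of H) -> Z).
Hypothesis f_bal : balanced (grpalg_incl H) f.

Definition model_map (w : W) : Z :=
  \sum_(g | is_repr g) f (grp_basis g) ((val w : kG) g).

Lemma model_map_is_zmod_morphism : zmod_morphism model_map.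
Proof.
case: f_bal => _ fDr _ v w; rewrite /model_map -sumrB; apply: eq_bigr => g _.
apply/eqP; rewrite eq_sym subr_eq -fDr; apply/eqP; congr f.
by rewrite !ffunE subrK.
Qed.

Lemma balanced_basisZ (a d : k) g (s : subg_of H) :
  f (a *: grp_basis (g * sgval s)%g) d = f (grp_basis g) (a * d).
Proof.
pose b : grpalg k (subg_of H) := [ffun t => if t == s then a else 0].
have -> : a *: grp_basis (g * sgval s)%g = grp_basis g * grpalg_incl H b.
  apply/ffunP => h; rewrite !ffunE /= (bigD1 g) //= big1 ?addr0; last first.
    by move=> l lg; rewrite ffunE (negbTE lg) mul0r.
  rewrite ffunE eqxx mul1r ffunE -(inj_eq (mulgI g^-1%g)) mulKg.
  case: eqP => [->|ne].
    rewrite (bigD1 s) //= ffunE eqxx big1 ?addr0 /GRing.scale /= ?mulr1 //.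
    by move=> t /andP[_ /negbTE ts]; rewrite ffunE ts.
  rewrite big1 /GRing.scale /= ?mulr0 // => t /eqP te; rewrite ffunE.
  by case: eqP => // ts; case: ne; rewrite -te ts.
case: f_bal => _ _ ->; congr f; rewrite /GRing.scale /= /trivmod_scale.
congr (_ * _); rewrite /augmentation (bigD1 s) //= ffunE eqxx big1 ?addr0 //.
by move=> t /negbTE ts; rewrite ffunE ts.
Qed.

Lemma balanced_basis g h (c : k) : h \in H ->
  f (grp_basis (g * h)%g) c = f (grp_basis g) c.
Proof.
move=> hH; have := balanced_basisZ 1 c g (subg H h).
by rewrite subgK // scale1r mul1r.
Qed.

Lemma balancedZ (a d : k) g : f (a *: grp_basis g) d = f (grp_basis g) (a * d).
Proof. by have := balanced_basisZ a d g 1%g; rewrite /= mulg1. Qed.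

Lemma model_mapE a c : model_map (model_tensor a c) = f a c.
Proof.
case: (f_bal) => fDl fDr _.
have f0l d : f 0 d = 0 by apply: (addrI (f 0 d)); rewrite -fDl !addr0.
have f0r a' : f a' 0 = 0 by apply: (addrI (f a' 0)); rewrite -fDr !addr0.
transitivity (\sum_g f (grp_basis g) (a g * (c : k))).
  rewrite sum_repr; apply: eq_bigr => g _; rewrite model_tensorE.
  rewrite (big_morph (f _) (fDr _) (f0r _)); apply: eq_bigr => h hH.
  by rewrite balanced_basis.
rewrite [in RHS](grpalg_sum_basis a).
rewrite (big_morph (fun u => f u c) (fun u v => fDl u v c) (f0l c)).
by apply: eq_bigr => g _; rewrite balancedZ.
Qed.

End UniversalMap.

Lemma model_gen_span (w : W) :
  w = \sum_(g | is_repr g) model_tensor (grp_basis g) ((val w : kG) g).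
Proof.
case: w => u uH; apply/val_inj/ffunP => x; rewrite raddf_sum sum_ffunE /=.
under eq_bigr => g _ do rewrite model_tensorE.
transitivity (\sum_g grp_basis g x * u g).
  rewrite (bigD1 x) //= ffunE eqxx mul1r big1 ?addr0 // => g gx.
  by rewrite ffunE eq_sym (negbTE gx) mul0r.
rewrite sum_repr; apply: eq_bigr => g _.
rewrite [RHS](reindex_inj invg_inj) /=; apply: eq_big => h; first by rewrite groupV.
move=> hH; rewrite (coset_constantP _ uH) //; congr (_ * _).
by rewrite !ffunE -(inj_eq (mulIg h) (x * h^-1)%g) mulgKV.
Qed.

Lemma model_is_tensor : is_tensor (grpalg_incl H) model_tensor.
Proof.
split; [exact: model_balanced | by move=> a a' c; rewrite /model_tensor scalerA |].
move=> Z f f_bal; pose F : {additive W -> Z} := HB.pack (model_map f)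
  (GRing.isZmodMorphism.Build W Z (model_map f) (model_map_is_zmod_morphism f_bal)).
exists F; split=> [a c|g gE w]; first exact: model_mapE.
rewrite {1}(model_gen_span w) raddf_sum; apply: eq_bigr => h _; exact: gE.
Qed.

Lemma induced_trivial_exists : exists V : lmodType kG, induced_trivial H V.
Proof. by exists W, model_tensor; apply: model_is_tensor. Qed.

End InducedTrivialModel.

(* Main.v *)
Require Import Defs.
From HB Require Import structures.
From mathcomp Require Import all_boot all_order all_algebra all_fingroup.
From mathcomp Require Import ring boolp.

Set Implicit Arguments.
Unset Strict Implicit.
Unset Printing Implicit Defensive.

Import GRing.Theory.
Local Open Scope ring_scope.

(** Write V for the module induced from the trivial module of H1.  A kH-module W
    together with H1-fixed vectors w_1, ..., w_n of W, that is, with n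
    homomorphisms from V to W, glues to a kC-module k^n + W: the group G acts
    trivially on k^n, the group H acts on W, and alpha sends the i-th basis
    vector to w_i ([ext_module]).  Two such modules with the same W are
    isomorphic only if an automorphism U of W carries the tuple w to the tuple
    w' up to a linear substitution over k ([ext_module_iso]).

    A finite-dimensional module is a direct sum of indecomposables, so finite
    representation type leaves only finitely many isomorphism classes in each
    dimension ([finite_iso_classes]).  As k is infinite, every family of tuples
    indexed by k contains two members whose modules are isomorphic.  Each part
    of the theorem comes from a family in which this is impossible.

    - Parts (2) and (3) use n = 1 and a line s phi + psi in Hom(V, W)
      ([pencil]).  If a simple module S occurs twice in Top V, take W = S and
      let phi, psi be the two projections: U must be a scalar on S, which forces
      equal parameters.  If f : M -> N is a map between summands, take W = N,
      phi = f o pr_M and psi = pr_N: Fitting's lemma makes the loops M -> N -> M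
      and N -> M -> N nilpotent, because M and N are not isomorphic.  Comparing
      U on N and on M shows that f is fixed by precomposition with the nilpotent
      loop on M, hence is zero.
    - Part (1) uses n = 2, W = V and the pair (v, x v), where v is the generator
      of V and x is in E = End(V).  An isomorphism between the modules of x and
      z expresses x as a fraction (c + d z)/(a + b z).  So x lies in k[z], and
      applying this to a line through an element x of largest degree
      shows that E = k[x] ([mobius_generator]).  If the degree is
      at least 4, pick an eigenvector e of multiplication by x in k[x]; the
      elements x + s e are pairwise not related by fractions because 1, x, x^2
      and e are independent ([mobius_finite_rank]).

    The dimension of E is the number of double cosets because an endomorphism is
    determined by the image of v, an arbitrary function on H that is constant on
    the double cosets of H1 ([hom_dim_induced]). *)

(** * Algebras with finitely many classes under fractional substitutions *)

(** An algebraically closed field is infinite, so no finite set of labels can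
    separate its elements. *)
Lemma closed_field_pigeonhole (k : closedFieldType) (I : finType)
    (Q : k -> I -> Prop) :
  (forall t, exists i, Q t i) -> exists s t i, [/\ s != t, Q s i & Q t i].
Proof.
move=> /choice[cls clsP].
have exu n : exists s : seq k, uniq s && (size s == n).
  elim: n => [|n [s /andP[us /eqP <-]]]; first by exists [::].
  have /closed_nonrootP[a] : \prod_(b <- s) ('X - b%:P) != 0.
    by rewrite monic_neq0 // monic_prod_XsubC.
  by rewrite root_prod_XsubC => aNs; exists (a :: s); rewrite /= aNs us eqxx.
have [s /andP[us /eqP sz]] := exu #|I|.+1.
have : ~~ uniq (map cls s).
  apply/negP => /card_uniqP cs; have := max_card (mem (map cls s)).
  by rewrite cs size_map sz ltnn.
move=> /(uniqPn (cls 0))[i [j [ij js eij]]]; rewrite size_map in js.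
have is_ := ltn_trans ij js.
rewrite !(nth_map 0) // in eij.
exists s`_i, s`_j, (cls s`_i); split=> //; last by rewrite eij.
by rewrite nth_uniq // neq_ltn ij.
Qed.

(** By the Cayley-Hamilton theorem the inverse of an invertible matrix is a
    polynomial in that matrix. *)
Lemma horner_mx_unit_inverse (F : fieldType) n (Y : 'M[F]_n.+1) (p : {poly F}) :
  horner_mx Y p \in unitmx ->
  exists q : {poly F}, horner_mx Y (p * q) = 1.
Proof.
set U := horner_mx Y p => uU.
have /factor_theorem[q qE] : root (char_poly U - (char_poly U).[0]%:P) 0.
  by rewrite rootE !hornerE subrr.
have d0 : (char_poly U).[0] != 0.
  rewrite -rootE -eigenvalue_root_char; apply/eigenvalueP => -[v /eqP].
  rewrite scale0r => /eqP vU; apply/negP; rewrite negbK.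
  by rewrite -(mulmxK uU v) vU mul0mx.
exists (- (char_poly U).[0]^-1%:P * (q \Po p)).
have qU : U * horner_mx U q = - (char_poly U).[0]%:M.
  rewrite -{1}(horner_mx_X U) -rmorphM mulrC -['X]subr0 -qE.
  by rewrite rmorphB /= Cayley_Hamilton sub0r horner_mx_C.
have cE : horner_mx Y (q \Po p) = horner_mx U q.
  elim/poly_ind: q {qE qU} => [|q c IH]; first by rewrite comp_poly0 !rmorph0.
  rewrite comp_poly_MXaddC !rmorphD !rmorphM /= IH !horner_mx_C.
  by rewrite horner_mx_X.
rewrite mulrCA rmorphM rmorphN /= horner_mx_C rmorphM /= cE qU.
rewrite mulNr mulrN opprK.
by rewrite -[_ * _]/(_ *m _) -scalar_mxM mulVf.
Qed.

Section MatrixPolynomials.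
Variables (F : fieldType) (n : nat).
Implicit Types X Y Z : 'M[F]_n.+1.

Lemma degree_mxminpoly_le X : (degree_mxminpoly X <= n.+1)%N.
Proof.
rewrite -ltnS -size_mxminpoly -(size_char_poly X) dvdp_leq ?mxminpoly_dvd_char //.
by rewrite monic_neq0 ?char_poly_monic.
Qed.

Definition poly_in X Y := exists p : {poly F}, horner_mx Y p = X.

Lemma horner_mx_linear Y (a b : F) :
  horner_mx Y (a%:P + b *: 'X) = a%:M + b *: Y.
Proof. by rewrite rmorphD /= horner_mx_C linearZ /= horner_mx_X. Qed.

Lemma horner_mxZ Y (a : F) p : horner_mx Y (a%:P * p) = a *: horner_mx Y p.
Proof. by rewrite mul_polyC linearZ. Qed.

Lemma poly_in_mobius X Y (a b c d : F) :
  a%:M + b *: Y \in unitmx -> X *m (a%:M + b *: Y) = c%:M + d *: Y ->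
  poly_in X Y.
Proof.
rewrite -!horner_mx_linear => /horner_mx_unit_inverse[q qP] E.
exists ((c%:P + d *: 'X) * q).
by rewrite rmorphM /= -E -[X *m _]/(X * _) -mulrA -rmorphM /= qP mulr1.
Qed.

Lemma mx_in_horner q (R : 'M[F]_(q, n.+1 ^ 2)) X :
  (1%:M \in R)%MS -> (forall Y Z, (Y \in R)%MS -> (Z \in R)%MS -> (Y *m Z \in R)%MS) ->
  (X \in R)%MS -> forall p, (horner_mx X p \in R)%MS.
Proof.
move=> R1 RM XR; elim/poly_ind => [|p c IH]; first by rewrite rmorph0 linear0 sub0mx.
rewrite rmorphD rmorphM /= horner_mx_X horner_mx_C linearD addmx_sub ?RM //.
by rewrite -scalemx1 linearZ scalemx_sub.
Qed.

End MatrixPolynomials.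

(** [R] is a matrix algebra and [Q] labels its elements with finitely many
    labels; elements with the same label are related by a fractional linear
    substitution, a relation with at most three-dimensional orbits. *)
Section Mobius.
Variables (k : closedFieldType) (n q : nat) (R : 'M[k]_(q, n.+1 ^ 2)).
Variables (I : finType) (Q : 'M[k]_n.+1 -> I -> Prop).
Hypothesis R1 : (1%:M \in R)%MS.
Hypothesis RM :
  forall Y Z : 'M_n.+1, (Y \in R)%MS -> (Z \in R)%MS -> (Y *m Z \in R)%MS.
Hypothesis Qex : forall X, (X \in R)%MS -> exists i, Q X i.
Hypothesis Qeq : forall X Y i, Q X i -> Q Y i ->
  exists a b c d : k,
    a%:M + b *: Y \in unitmx /\ X *m (a%:M + b *: Y) = c%:M + d *: Y.

Let line_in X Z t : (X \in R)%MS -> (Z \in R)%MS -> (X + t *: Z \in R)%MS.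
Proof. by move=> XR ZR; rewrite linearD linearZ addmx_sub // scalemx_sub. Qed.

Lemma mobius_line X Z : (X \in R)%MS -> (Z \in R)%MS ->
  exists s t a b c d : k, [/\ s != t, a%:M + b *: (X + t *: Z) \in unitmx &
    (X + s *: Z) *m (a%:M + b *: (X + t *: Z)) = c%:M + d *: (X + t *: Z)].
Proof.
move=> XR ZR.
have [|s [t [i [st Qs Qt]]]] :=
    @closed_field_pigeonhole k I (fun t i => Q (X + t *: Z) i).
  by move=> t; apply/Qex/line_in.
have [a [b [c [d [u E]]]]] := Qeq Qs Qt.
by exists s, t, a, b, c, d.
Qed.

(** Let X have the largest degree and let Z be any element.  Two points of the
    line X + t Z have the same label, so one is a polynomial in the other, which
    is therefore of the form Y with X and Z in k[Y].  Maximality gives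
    k[Y] = k[X], so Z is in k[X]. *)
Lemma mobius_generator : exists2 X, (X \in R)%MS &
  (R <= powers_mx X (degree_mxminpoly X))%MS.
Proof.
pose P m := `[< exists2 X, (X \in R)%MS & degree_mxminpoly X = m >].
have [||r /asboolP[X XR Xr] rmax] := @ex_maxnP P n.+1.
- by exists (degree_mxminpoly (1%:M : 'M[k]_n.+1)); apply/asboolP; exists 1%:M.
- by move=> m /asboolP[X _ <-]; apply: degree_mxminpoly_le.
exists X => //.
suff RX (Z : 'M_n.+1) : (Z \in R)%MS -> (Z \in powers_mx X (degree_mxminpoly X))%MS.
  apply/row_subP => i; rewrite -(vec_mxK (row i R)); apply: RX.
  by rewrite vec_mxK row_sub.
move=> ZR; have [s [t [a [b [c [d [st u E]]]]]]] := mobius_line XR ZR.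
set Y := X + t *: Z in u E.
have YR : (Y \in R)%MS by apply: line_in.
have [p pE] := poly_in_mobius u E.
have st0 : s - t != 0 by rewrite subr_eq0.
have ZY : horner_mx Y ((s - t)^-1 *: (p - 'X)) = Z.
  rewrite linearZ /= rmorphB /= pE horner_mx_X opprD addrACA subrr add0r.
  by rewrite -scalerBl scalerA mulVf // scale1r.
have XY : horner_mx Y ('X - t *: ((s - t)^-1 *: (p - 'X))) = X.
  by rewrite rmorphB /= linearZ /= ZY horner_mx_X addrK.
have subXY : (powers_mx X (degree_mxminpoly X) <= powers_mx Y (degree_mxminpoly Y))%MS.
  apply/row_subP => i; rewrite rowK -[X in X ^+ i]horner_mx_X -rmorphXn /=.
  apply: mx_in_horner.
  - exact: minpoly_mx1.
  - exact: minpoly_mxM.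
  - by rewrite -XY horner_mx_mem.
(* k[X] is contained in k[Y], and its dimension is maximal, so both agree. *)
have /mxrank_leqif_sup [_] := subXY.
have -> : (\rank (powers_mx X (degree_mxminpoly X)) ==
          \rank (powers_mx Y (degree_mxminpoly Y))).
  rewrite eqn_leq mxrankS //= Xr.
  have := minpoly_mx_free Y; have := minpoly_mx_free X.
  rewrite /row_free Xr => /eqP-> /eqP->; apply: rmax; apply/asboolP; by exists Y.
by move/esym => YX; apply: submx_trans YX; rewrite -ZY horner_mx_mem.
Qed.

(** The algebra is k[X].  Factor the minimal polynomial of X as g (x - th); then
    e = g(X) satisfies X e = th e and e^2 = g(th) e.  A fractional relation
    between X + s e and X + t e becomes, after these reductions, a linear
    relation between 1, X, X^2 and e; in degree at least 4 it is trivial, and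
    comparing coefficients gives s = t. *)
Lemma mobius_finite_rank : (\rank R <= 3)%N.
Proof.
have [X XR RX] := mobius_generator.
apply: leq_trans (mxrankS RX) _; apply: leq_trans (rank_leq_row _) _.
rewrite leqNgt; apply/negP => r4.
set p := mxminpoly X.
have sp : size p = (degree_mxminpoly X).+1 by rewrite size_mxminpoly.
have [th /factor_theorem[g pE]] : exists th, root p th.
  by apply/closed_rootP; rewrite sp eqSS -lt0n; case: (degree_mxminpoly X) r4.
have g0 : g != 0.
  by apply/eqP => g0; have := sp; rewrite pE g0 mul0r size_poly0.
have sg : size g = degree_mxminpoly X.
  by apply: succn_inj; rewrite -sp pE size_Mmonic ?monicXsubC // size_XsubC addn2.
(* A nonzero polynomial that kills X has at least the degree of [p]. *)
have small (f : {poly k}) : (size f <= size g)%N -> horner_mx X f = 0 -> f = 0.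
  move=> sf /mxminpoly_min; case: (eqVneq f 0) => // f0 /(dvdp_leq f0).
  by rewrite -/p sp -sg leqNgt ltnS sf.
have /factor_theorem[g' gE] : root (g - g.[th]%:P) th.
  by rewrite rootE !hornerE subrr.
set e := horner_mx X g.
have eR : (e \in R)%MS by apply: mx_in_horner.
have [s [t [a [b [c [d [st u E]]]]]]] := mobius_line XR eR.
(* [K] is the coefficient of [e] once X e and e^2 are reduced, and [f] is the
   whole relation, as a polynomial in X of degree less than that of [p]. *)
pose K := s * a + b * (s + t) * th + b * s * t * g.[th] - d * t.
pose f := (b%:P * 'X^2 + (a - d)%:P * 'X - c%:P + K%:P * g : {poly k}).
have f0 : f = 0.
  apply: small.
    rewrite /f !mul_polyC; have sZ r (h : {poly k}) m :
        (size h <= m)%N -> (size (r *: h) <= m)%N.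
      by apply: leq_trans; apply: size_scale_leq.
    have sD (h1 h2 : {poly k}) m :
        (size h1 <= m)%N -> (size h2 <= m)%N -> (size (h1 + h2)%R <= m)%N.
      by move=> s1 s2; rewrite (leq_trans (size_polyD _ _)) // geq_max s1.
    have g4 : (3 < size g)%N by rewrite sg.
    rewrite !sD ?sZ // ?size_polyXn ?size_polyX ?size_polyN ?size_polyC //.
    + exact: leq_trans g4.
    + exact: leq_trans g4.
    + by apply: leq_trans g4; case: eqP.
  pose P := ('X + s%:P * g) * (a%:P + b%:P * ('X + t%:P * g))
     - (c%:P + d%:P * ('X + t%:P * g)).
  have -> : f = P - ((b * (s + t))%:P + (b * s * t)%:P * g') * p.
    have h1 : g' * p = g * (g - g.[th]%:P) by rewrite gE pE; ring.
    rewrite mulrDl -[_ * g' * p]mulrA h1 pE /f /P /K.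
    by rewrite !(polyCD, polyCM, polyCN); ring.
  rewrite rmorphB [X in _ - X]rmorphM /= mx_root_minpoly mulr0 subr0 /P.
  rewrite rmorphB rmorphM /= !rmorphD /= !horner_mxZ !rmorphD /= !horner_mxZ !horner_mx_C.
  rewrite !horner_mx_X; apply/eqP; rewrite subr_eq0; apply/eqP; exact: E.
(* [g] has degree at least 3, so it does not interfere with 1, X and X^2. *)
have g3 : (3 <= (size g).-1)%N by rewrite -ltnS prednK ?sg // (leq_trans _ r4).
have coef i : f`_i = 0 by rewrite f0 coef0.
have coefsm i : (a - d) * (i == 1)%:R + b * (i == 2)%:R - c * (i == 0)%:R
     + K * g`_i = 0.
  transitivity f`_i; last exact: coef.
  rewrite /f !(coefD, coefN, coefCM, coefX, coefXn, coefC) /=.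
  by case: i => [|[|i]] /=; ring.
have K0 : K = 0.
  have := coefsm (size g).-1.
  have l0 : g`_(size g).-1 != 0 by rewrite -lead_coefE lead_coef_eq0.
  move: l0 g3; case: (size g).-1 => [|[|[|m]]] //= l0 _.
  rewrite !mulr0 subr0 !add0r => /eqP.
  by rewrite mulf_eq0 (negbTE l0) orbF => /eqP.
have b0 : b = 0.
  by have := coefsm 2; rewrite K0 /= mulr1 !mulr0 mul0r subr0 !addr0 add0r.
have ad : a = d.
  have := coefsm 1; rewrite K0 /= mulr1 !mulr0 mul0r subr0 !addr0 => /eqP.
  by rewrite subr_eq0 => /eqP.
have a0 : a != 0.
  by apply: contraTneq u => ->; rewrite b0 !scale0r addr0 -scalemx1 scale0r unitmxE det0 unitr0.
move: K0; rewrite /K b0 -ad !mul0r !addr0 mulrC -mulrBr => /eqP.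
by rewrite mulf_eq0 (negbTE a0) subr_eq0 (negbTE st).
Qed.
End Mobius.

(** * Direct sums and isomorphisms of modules *)

(** Homomorphisms are often built from choice functions; this turns a function
    with a proof of linearity into a bundled map. *)
Lemma linear_pack (A : pzRingType) (M N : lmodType A) (f : M -> N) :
  linear f -> exists F : {linear M -> N}, F =1 f.
Proof.
move=> fl.
pose F : {linear M -> N} := HB.pack f (GRing.isLinear.Build A M N _ f fl).
by exists F.
Qed.

Lemma additive_pack (M N : zmodType) (f : M -> N) :
  zmod_morphism f -> exists F : {additive M -> N}, F =1 f.
Proof.
move=> fl.
pose F : {additive M -> N} := HB.pack f (GRing.isZmodMorphism.Build M N f fl).
by exists F.
Qed.

Section Iso.
Variable A : pzRingType.
Implicit Types M N P : lmodType A.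

Lemma linear_inverse M N (f : {linear M -> N}) : bijective f ->
  exists g : {linear N -> M}, cancel f g /\ cancel g f.
Proof.
move=> [g fK gK].
have [|G GE] := @linear_pack A N M g.
  by move=> a m n; apply: (can_inj fK); rewrite linearP !gK.
by exists G; split=> m; rewrite GE.
Qed.

Lemma isomorphic_sym M N : isomorphic M N -> isomorphic N M.
Proof. by move=> [f /linear_inverse[g [fK gK]]]; exists g; exists f. Qed.

Lemma isomorphic_trans M N P :
  isomorphic M N -> isomorphic N P -> isomorphic M P.
Proof.
move=> [f fb] [g gb]; have [|h hE] := @linear_pack A M P (g \o f).
  by move=> a m n /=; rewrite !linearP.
exists h; apply: (eq_bij (bij_comp gb fb)) => m; exact/esym/hE.
Qed.

Lemma submodB M (S : submodClosed M) m n : m \in S -> n \in S -> m - n \in S.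
Proof. by move=> mS nS; rewrite -scaleN1r rpredD ?rpredZ. Qed.

Lemma complementary_sym M (S T : submodClosed M) :
  complementary S T -> complementary T S.
Proof.
move=> [ST I]; split=> [m|m mT mS]; last exact: I.
by have [s [t [sS tT ->]]] := ST m; exists t, s; rewrite addrC.
Qed.

(** The component in [S] of an element is chosen; uniqueness of the
    decomposition makes the choice linear. *)
Lemma complement_projection M (S T : submodClosed M) : complementary S T ->
  exists p : {linear M -> submodule S},
    (forall s : submodule S, p (val s) = s) /\ (forall m, m - val (p m) \in T).
Proof.
move=> [ST I].
have /choice[p pT] : forall m, exists s : submodule S, m - val s \in T.
  move=> m; have [s [t [sS tT ->]]] := ST m.
  by exists (Sub s sS); rewrite /= addrC addKr.
have pE m (s : submodule S) : m - val s \in T -> p m = s.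
  move=> msT; apply/eqP; rewrite -subr_eq0; apply/eqP/val_inj.
  apply: I; first exact: valP.
  have -> : val (p m - s) = (m - val s) - (m - val (p m)).
    by rewrite /= opprB [RHS]addrC addrA subrK.
  exact: submodB.
have [|P PE] := @linear_pack A M (submodule S) p.
  move=> a m n; apply: pE.
  have -> : a *: m + n - val (a *: p m + p n) = a *: (m - val (p m)) + (n - val (p n)).
    by rewrite /= scalerBr opprD addrACA.
  by rewrite rpredD ?rpredZ.
exists P; split=> [s|m]; rewrite PE //; apply: pE; by rewrite subrr rpred0.
Qed.

Lemma direct_summand_projection M (S : submodClosed M) : direct_summand S ->
  exists p : {linear M -> submodule S}, forall s : submodule S, p (val s) = s.
Proof. by move=> [T /complement_projection[p [pK _]]]; exists p. Qed.

Lemma isomorphic_prod M (S T : submodClosed M) N P : complementary S T ->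
  isomorphic (submodule S) N -> isomorphic (submodule T) P ->
  isomorphic M (N * P)%type.
Proof.
move=> ST [f [f' fK f'K]] [g [g' gK g'K]].
have [p [pK pT]] := complement_projection ST.
have [q [qK qS]] := complement_projection (complementary_sym ST).
have valqP m : val (q m) = m - val (p m).
  apply/eqP; rewrite -subr_eq0; apply/eqP; apply: ST.2; last first.
    by apply: submodB; [apply: valP | apply: pT].
  have -> : val (q m) - (m - val (p m)) = val (p m) - (m - val (q m)).
    by rewrite !opprB addrCA addrA.
  by apply: submodB; [apply: valP | apply: qS].
have pq0 s : q (val (s : submodule S)) = 0.
  by apply/val_inj; rewrite valqP pK subrr.
have qp0 t : p (val (t : submodule T)) = 0.
  apply/val_inj; have := valqP (val t); rewrite qK => /esym/eqP.
  by rewrite subr_eq addrC -subr_eq subrr => /eqP <-.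
have [|F FE] := @linear_pack A M (N * P)%type (fun m => (f (p m), g (q m))).
  by move=> a m n; rewrite !linearP.
exists F; exists (fun u => val (f' u.1) + val (g' u.2)) => [m|[u v]]; rewrite FE /=.
  by rewrite fK gK valqP addrC subrK.
by rewrite (linearD p) (linearD q) pK qK pq0 qp0 addr0 add0r f'K g'K.
Qed.

End Iso.

(** * Modules of bounded dimension *)

Section Dim.
Variables (k : fieldType) (A : pzRingType) (sg : k -> A).
Implicit Types M N P : lmodType A.

(** The scalars reach a module only through [sg : k -> A].  Bounding a dimension
    by a surjection from k^D, not by a basis, makes the bound pass to
    quotients and direct summands at once. *)
Definition kdim_le D M := exists g : {additive 'rV[k]_D -> M},
  (forall c v, g (c *: v) = sg c *: g v) /\ (forall m, exists v, g v = m).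

Lemma kdim_le_surj D M N (f : {linear M -> N}) :
  (forall n, exists m, f m = n) -> kdim_le D M -> kdim_le D N.
Proof.
move=> fS [g [gZ gS]].
have [|h hE] := @additive_pack 'rV[k]_D N (f \o g).
  by move=> u v /=; rewrite !raddfB.
exists h; split=> [c v|n]; first by rewrite !hE /= gZ linearZ.
by have [m <-] := fS n; have [v <-] := gS m; exists v; rewrite hE.
Qed.

(** A nonzero vector of the kernel with nonzero i-th coordinate allows every
    preimage to be moved into the hyperplane where that coordinate is 0. *)
Lemma kdim_le_drop D M (g : {additive 'rV[k]_D.+1 -> M}) v :
  (forall c v, g (c *: v) = sg c *: g v) -> (forall m, exists v, g v = m) ->
  v != 0 -> g v = 0 -> kdim_le D M.
Proof.
move=> gZ gS /rV0Pn[i vi] gv.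
pose ins (w : 'rV[k]_D) : 'rV[k]_D.+1 := \row_j oapp (w 0) 0 (unlift i j).
have insD (c : k) u w : ins (c *: u + w) = c *: ins u + ins w.
  by apply/rowP => j; rewrite !mxE; case: unliftP => [j' _|_] /=;
    rewrite ?mxE // mulr0 addr0.
have [|h hE] := @additive_pack 'rV[k]_D M (g \o ins).
  by move=> u w /=; rewrite -raddfB addrC -scaleN1r insD scaleN1r addrC.
exists h; split=> [c w|m].
  have i0 : ins 0 = 0 by apply/rowP => j; rewrite !mxE; case: unlift => //= j'; rewrite mxE.
  by rewrite !hE /= -[c *: w]addr0 insD i0 addr0 gZ.
have [u <-] := gS m; pose u' := u - (u 0 i / v 0 i) *: v.
have <- : g u' = g u.
  by rewrite raddfB gZ gv scaler0 subr0.
exists (\row_j u' 0 (lift i j)); rewrite hE /=; congr (g _); apply/rowP => j.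
rewrite !mxE; case: unliftP => [j' ->|->] /=; first by rewrite !mxE.
by rewrite divfK // subrr.
Qed.

Lemma kdim_bij D M : kdim_le D M ->
  exists D' (g : {additive 'rV[k]_D' -> M}),
    (forall c v, g (c *: v) = sg c *: g v) /\ bijective g.
Proof.
elim: D => [|D IH] [g [gZ gS]].
  have [h hK] := choice gS.
  exists 0%N, g; split=> //; exists h => // v.
  by rewrite (thinmx0 v) [LHS]thinmx0.
case: (pselect (forall v, g v = 0 -> v = 0)) => [g0|].
  have [h hK] := choice gS.
  exists D.+1, g; split=> //; exists h => // v.
  by apply/eqP; rewrite -subr_eq0; apply/eqP/g0; rewrite raddfB hK subrr.
move=> /existsNP[v /not_implyP[gv /eqP v0]].
exact: IH (kdim_le_drop gZ gS v0 gv).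
Qed.

Lemma kdim_le_summand D M (S T : submodClosed M) : complementary S T ->
  (exists2 t, t \in T & t != 0) -> kdim_le D.+1 M -> kdim_le D (submodule S).
Proof.
move=> ST [t tT t0] [g [gZ gS]].
have [p [pK pT]] := complement_projection ST.
have pS s : exists m, p m = s by exists (val s).
have [|h hE] := @additive_pack 'rV[k]_D.+1 (submodule S) (p \o g).
  by move=> u v /=; rewrite !raddfB.
have [v gv] := gS t.
apply: (@kdim_le_drop D _ h v).
- by move=> c u; rewrite !hE /= gZ linearZ.
- by move=> s; have [u gu] := gS (val s); exists u; rewrite hE /= gu pK.
- by apply: contraNneq t0 => v0; rewrite -gv v0 raddf0.
rewrite hE /= gv; apply/val_inj; apply: ST.2; first exact: valP.
by rewrite -[val _](subKr t); apply: submodB.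
Qed.

Lemma kdim_le_fg D M : kdim_le D M -> finitely_generated M.
Proof.
move=> [g [gZ gS]]; exists D, (fun i => g (delta_mx 0 i)) => m.
have [v <-] := gS m; exists (fun i => sg (v 0 i)).
rewrite {1}(row_sum_delta v) raddf_sum; apply: eq_bigr => i _; exact: gZ.
Qed.

(** Induction on the dimension: a module that is not indecomposable is the
    product of two modules of smaller dimension, so products of two
    representatives from the previous step, together with the given
    indecomposables, represent all modules. *)
Lemma finite_iso_classes D : finite_representation_type A ->
  exists (I : finType) (R : I -> lmodType A), forall M,
    nontrivial M -> kdim_le D M -> exists i, isomorphic M (R i).
Proof.
move=> [n [F FP]]; elim: D => [|D [I [R RP]]].
  exists void, (fun v : void => match v with end) => M [m m0] [g [gZ gS]].
  have [v gv] := gS m; case/eqP: m0.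
  by rewrite -gv (thinmx0 v) raddf0.
exists ('I_n + I * I)%type, (fun j : 'I_n + I * I => match j with
  | inl i => F i | inr ij => (R ij.1 * R ij.2)%type end) => M M0 MD.
case: (pselect (indecomposable M)) => [Mi|Mi].
  by have [i Fi] := FP M (kdim_le_fg MD) Mi; exists (inl i).
have [S [T [ST S0 T0]]] : exists S T : submodClosed M,
    [/\ complementary S T, exists2 s, s \in S & s != 0 & exists2 t, t \in T & t != 0].
  apply: contrapT => N; apply: Mi; split=> // S T ST; apply: contrapT => /not_orP[a b].
  apply: N; exists S, T; split=> //.
    by move: a => /existsNP[s /not_implyP[sS /eqP s0]]; exists s.
  by move: b => /existsNP[s /not_implyP[sS /eqP s0]]; exists s.
have nt (U : submodClosed M) : (exists2 s, s \in U & s != 0) -> nontrivial (submodule U).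
  move=> [s sU s0]; exists (Sub s sU); apply: contraNneq s0 => /(congr1 val) /= ->.
  by [].
have [i iP] := RP _ (nt _ S0) (kdim_le_summand ST T0 MD).
have [j jP] := RP _ (nt _ T0) (kdim_le_summand (complementary_sym ST) S0 MD).
by exists (inr (i, j)); apply: isomorphic_prod ST iP jP.
Qed.

End Dim.

(** * Fitting's lemma *)

Lemma submod_pack (A : pzRingType) (M : lmodType A) (P : M -> Prop) :
  P 0 -> (forall a m n, P m -> P n -> P (a *: m + n)) ->
  exists S : submodClosed M, forall m, m \in S <-> P m.
Proof.
move=> P0 Pl; pose p : {pred M} := fun m => `[< P m >].
have pc : submod_closed p.
  split=> [|a m n /asboolP Pm /asboolP Pn]; apply/asboolP => //; exact: Pl.
pose S : submodClosed M := HB.pack p (GRing.isSubmodClosed.Build A M p pc).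
by exists S => m; split=> [/asboolP|Pm] //; apply/asboolP.
Qed.

Section Endo.
Variables (k : fieldType) (A : pzRingType) (sg : k -> A) (M : lmodType A).

Lemma endo_matrix n (th : {additive 'rV[k]_n -> M}) (f : {linear M -> M}) :
  (forall c v, th (c *: v) = sg c *: th v) -> bijective th ->
  exists X : 'M[k]_n, forall v, th (v *m X) = f (th v).
Proof.
move=> thZ [thi thK thiK].
exists (\matrix_i thi (f (th (delta_mx 0 i)))) => v.
rewrite mulmx_sum_row raddf_sum {2}(row_sum_delta v) raddf_sum linear_sum.
by apply: eq_bigr => i _; rewrite rowK !thZ thiK linearZ.
Qed.

(** Choose i > 0 with the rank of r^i minimal, and put q = r^i.  Then q and q^2
    have the same kernel and the same image, so the module is the sum of the
    kernel and the image of q; one of them is zero. *)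
Lemma fitting D (r : {linear M -> M}) : kdim_le sg D M -> indecomposable M ->
  bijective r \/ exists i, forall m, iter i r m = 0.
Proof.
move=> /kdim_bij[n [th [thZ thB]]] [_ Mi].
have iterL i : linear (iter i r).
  by elim: i => [|i IH] a u v //=; rewrite IH linearP.
have /choice[X XE] : forall i, exists X : 'M[k]_n, forall v,
    th (v *m X) = iter i r (th v).
  move=> i; have [ri riE] := linear_pack (iterL i).
  by have [X XE] := endo_matrix ri thZ thB; exists X => v; rewrite XE riE.
have XD i j : X (i + j)%N = X j *m X i.
  apply/row_matrixP => l; rewrite !rowE mulmxA; apply: (bij_inj thB).
  by rewrite !XE iterD.
(* Only exponents i > 0 are compared, so that r^i injective implies r injective. *)
pose P d := `[< exists i, \rank (X i.+1) = d >].
have [|_ /asboolP[j <-] imin] := @ex_minnP P.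
  by exists (\rank (X 1%N)); apply/asboolP; exists 0%N.
set i := j.+1 in imin.
have rk : \rank (X i *m X i) = \rank (X i).
  apply/eqP; rewrite eqn_leq mxrankM_maxl -XD.
  by apply: imin; apply/asboolP; exists (j + i)%N.
have cap0 : (X i :&: kermx (X i) = 0)%MS.
  apply/eqP; rewrite -mxrank_eq0 -(eqn_add2l (\rank (X i *m X i))).
  by rewrite mxrank_mul_ker rk addn0.
have /submxP[Y YE] : (X i <= X i *m X i)%MS.
  have /mxrank_leqif_sup[_] := submxMl (X i) (X i).
  by rewrite rk eqxx => /esym.
set q := iter i r.
have iter0 l : iter l r 0 = 0 by elim: l => //= l ->; rewrite linear0.
have [thi thK thiK] := thB.
have kim m : q (q m) = 0 -> q m = 0.
  rewrite -(thiK m) /q -!XE => E.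
  have {}E : thi m *m X i *m X i = 0 by apply: (bij_inj thB); rewrite E raddf0.
  have : (thi m *m X i <= X i :&: kermx (X i))%MS.
    by rewrite sub_capmx submxMl; apply/sub_kermxP.
  by rewrite cap0 submx0 => /eqP->; rewrite raddf0.
have imq m : exists m', q m = q (q m').
  exists (th (thi m *m Y)); rewrite /q -!XE -{1}(thiK m) -XE; congr (th _).
  by rewrite {1}YE !mulmxA.
have [S SE] : exists S : submodClosed M, forall m, m \in S <-> q m = 0.
  apply: submod_pack => [|a u v qu qv]; first exact: iter0.
  by rewrite /q iterL -/q qu qv scaler0 addr0.
have [T TE] : exists T : submodClosed M, forall m, m \in T <-> exists m', m = q m'.
  apply: submod_pack => [|a u v [u' ->] [v' ->]]; first by exists 0; rewrite /q iter0.
  by exists (a *: u' + v'); rewrite /q iterL.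
have qB u v : q (u - v) = q u - q v.
  by rewrite addrC -scaleN1r /q iterL scaleN1r addrC.
have ST : complementary S T.
  split=> [m|m /SE qm /TE[m' mE]]; last by rewrite mE kim // -mE.
  have [m' mE] := imq m; exists (m - q m'), (q m'); rewrite subrK; split=> //.
    by apply/SE; rewrite qB mE subrr.
  by apply/TE; exists m'.
have [S0|T0] := Mi S T ST; last first.
  by right; exists i => m; apply/T0/TE; exists m.
left.
have rinj : injective r.
  move=> u v uv; apply/eqP; rewrite -subr_eq0; apply/eqP/S0/SE.
  by rewrite /q /i iterSr linearB uv subrr.
have /choice[h hE] m : exists m', r m' = m.
  have [m' mE] := imq m; exists (iter j r m'); apply/esym/eqP.
  by rewrite -subr_eq0; apply/eqP/S0/SE; rewrite -iterS -/i -/q qB mE subrr.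
by exists h => // m; apply: rinj; rewrite hE.
Qed.
End Endo.

(** * The group algebra *)

Lemma sum_delta (T : finType) (Z : zmodType) (F : T -> Z) t :
  \sum_s F s *+ (t == s) = F t.
Proof.
rewrite (bigD1 t) //= eqxx big1 ?addr0 // => s.
by rewrite eq_sym => /negbTE->.
Qed.

Section GroupAlgebraFacts.
Variables (k : fieldType) (gT : finGroupType).
Implicit Types (a b : grpalg k gT) (c : k).

Lemma grp_basisM (g h : gT) : grp_basis k g * grp_basis k h = grp_basis k (g * h)%g.
Proof.
apply/ffunP => l; rewrite ffunE (bigD1 g) //= !ffunE eqxx mul1r big1 ?addr0.
  by rewrite -(inj_eq (mulgI g) (g^-1 * l)%g) mulKVg.
by move=> m mg; rewrite ffunE (negbTE mg) mul0r.
Qed.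

Lemma grp_basis1 : grp_basis k (1%g : gT) = 1.
Proof. by apply/ffunP => g; rewrite !ffunE. Qed.

Lemma grpalg_scalerAr c a b : a * (c *: b) = c *: (a * b).
Proof.
apply/ffunP => g; rewrite !ffunE /= scaler_sumr; apply: eq_bigr => h _.
by rewrite ffunE /GRing.scale /= mulrCA.
Qed.

Lemma grpalg_scalar_central c a : c%:A * a = a * c%:A.
Proof. by rewrite grpalg_scalerAr mulr1 -scalerAl mul1r. Qed.

Definition fixed (A : {set gT}) (W : lmodType (grpalg k gT)) (w : W) :=
  forall h, h \in A -> grp_basis k h *: w = w.

End GroupAlgebraFacts.

(** * Modules over the category algebra *)

Section Extension.
Variables (k : fieldType) (C : finEICat) (x y : C) (alpha : homset x y).
Hypotheses (neq_xy : x != y) (ob_xy : forall z : C, z = x \/ z = y).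
Hypothesis hom_yx : #|homset y x| = 0%N.
Hypothesis transH : ltransitive x y.
Local Notation kC := (catalg k C).
Local Notation kH := (grpalg k (endgrp y)).
Implicit Types u v : kC.

Lemma ltransitive_witness (b : homset x y) : exists h : endgrp y, compose h alpha == b.
Proof. by have [h ->] := transH alpha b; exists h. Qed.

(** As H is transitive, every morphism from x to y is h alpha for some h; this
    picks one.  On vectors fixed by H1 the choice is immaterial. *)
Definition lquot (b : homset x y) : endgrp y := xchoose (ltransitive_witness b).

Lemma lquotK b : compose (lquot b) alpha = b.
Proof. exact/eqP/(xchooseP (ltransitive_witness b)). Qed.

Lemma sum_ob (Z : zmodType) (F : C -> Z) : \sum_z F z = F x + F y.
Proof.
rewrite (bigD1 x) //= (bigD1 y) /=; last by rewrite eq_sym.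
rewrite big1 ?addr0 // => z /andP[zx zy].
by case: (ob_xy z) => e; [rewrite e eqxx in zx | rewrite e eqxx in zy].
Qed.

Lemma sum_hom_yx (Z : zmodType) (F : homset y x -> Z) : \sum_f F f = 0.
Proof. by apply: big1 => f _; have := card0_eq hom_yx f. Qed.

(** The category algebra is an algebra of triangular matrices.  [corner_x] is
    its corner kG followed by the augmentation, [corner_y] its corner kH, and
    [corner_xy] replaces each morphism h alpha from x to y by h. *)
Definition corner_x u : k := \sum_(g : homset x x) catalg_coef u g.
Definition corner_y u : kH := [ffun h : endgrp y => catalg_coef u (h : homset y y)].
Definition corner_xy u : kH :=
  \sum_(b : homset x y) catalg_coef u b *: grp_basis k (lquot b).

Lemma corner_xD u v : corner_x (u + v) = corner_x u + corner_x v.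
Proof.
by rewrite /corner_x -big_split; apply: eq_bigr => g _; rewrite catalg_coefD.
Qed.

Lemma corner_yD u v : corner_y (u + v) = corner_y u + corner_y v.
Proof. by apply/ffunP => h; rewrite !ffunE catalg_coefD. Qed.

Lemma corner_xyD u v : corner_xy (u + v) = corner_xy u + corner_xy v.
Proof.
rewrite /corner_xy -big_split; apply: eq_bigr => g _.
by rewrite catalg_coefD scalerDl.
Qed.

Lemma catalg_coefZ (c : k) u a b (f : homset a b) :
  catalg_coef (c *: u) f = c * catalg_coef u f.
Proof. by rewrite /catalg_coef ffunE. Qed.

Lemma corner_xZ (c : k) u : corner_x (c *: u) = c * corner_x u.
Proof.
by rewrite /corner_x mulr_sumr; apply: eq_bigr => g _; rewrite catalg_coefZ.
Qed.

Lemma corner_yZ (c : k) u : corner_y (c *: u) = c *: corner_y u.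
Proof. by apply/ffunP => h; rewrite !ffunE catalg_coefZ. Qed.

Lemma corner_xyZ (c : k) u : corner_xy (c *: u) = c *: corner_xy u.
Proof.
rewrite /corner_xy scaler_sumr; apply: eq_bigr => b _.
by rewrite catalg_coefZ scalerA.
Qed.

Lemma corner_xM u v : corner_x (u * v) = corner_x u * corner_x v.
Proof.
transitivity (\sum_(h : homset x x) \sum_(f : homset x x) \sum_(g : homset x x)
  catalg_coef u f * catalg_coef v g * (compose f g == h)%:R).
  by apply: eq_bigr => h _; rewrite catalg_coefM sum_ob sum_hom_yx addr0.
rewrite exchange_big mulr_suml; apply: eq_bigr => f _ /=.
rewrite exchange_big mulr_sumr; apply: eq_bigr => g _ /=.
rewrite -mulr_sumr -[RHS]mulr1; congr (_ * _).
exact: (sum_delta (fun=> 1)).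
Qed.

(** The finite structures on [homset y y] and [endgrp y] are not convertible. *)
Lemma sum_endgrp (Z : zmodType) (F : homset y y -> Z) :
  \sum_f F f = \sum_(h : endgrp y) F (h : homset y y).
Proof. by rewrite (reindex (fun h : endgrp y => h : homset y y)) //; exists id. Qed.

Lemma corner_yM u v : corner_y (u * v) = corner_y u * corner_y v.
Proof.
apply/ffunP => l; rewrite !ffunE catalg_coefM sum_ob [X in X + _]big1 ?add0r; last first.
  by move=> f _; rewrite sum_hom_yx.
transitivity (\sum_(f : endgrp y) \sum_(g : endgrp y)
  catalg_coef u (f : homset y y) * catalg_coef v (g : homset y y) * ((f * g)%g == l)%:R).
  by rewrite sum_endgrp; apply: eq_bigr => f _; rewrite sum_endgrp.
apply: eq_bigr => f _; rewrite !ffunE.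
have fE (g : endgrp y) : (f * g == l)%g = (f^-1 * l == g)%g.
  by rewrite eq_sym -(inj_eq (mulgI f) (f^-1 * l)%g) mulKVg.
under eq_bigr => g _ do rewrite fE mulr_natr.
exact: sum_delta.
Qed.

Section Fixed.
Variables (W : lmodType kH) (w : W).
Hypothesis w_fixed : fixed (rorbit_stab alpha) w.

(** Here h alpha is in h' alpha G, so h'^-1 h stabilizes alpha G. *)
Lemma eq_on_rorbit (h h' : endgrp y) (g : endgrp x) :
  compose h alpha = compose (compose h' alpha) g ->
  grp_basis k h *: w = grp_basis k h' *: w.
Proof.
move=> E; have -> : h = (h' * (h'^-1 * h))%g by rewrite mulKVg.
rewrite -grp_basisM -scalerA w_fixed // inE.
have {}E : compose (h'^-1 * h)%g alpha = compose alpha g.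
  rewrite -composeA E -(composeA h') composeA.
  by rewrite [compose _ h'](mulVg (h' : endgrp y)) compose1m.
apply/eqP/setP => b; apply/imsetP/imsetP => [[_ /imsetP[g' _ ->] ->]|[g' _ ->]].
  by exists (g * g')%g; rewrite // composeA E -composeA.
exists (compose alpha (g^-1 * g')%g); first by apply: imset_f.
rewrite composeA E -composeA; congr (compose alpha _).
by rewrite -[RHS]/(g * (g^-1 * g'))%g mulKVg.
Qed.

Lemma corner_xyE u : corner_xy u *: w =
  \sum_(b : homset x y) (catalg_coef u b)%:A *: (grp_basis k (lquot b) *: w).
Proof.
rewrite scaler_suml; apply: eq_bigr => b _.
by rewrite scalerA -scalerAl mul1r.
Qed.

Lemma corner_yE u : corner_y u = \sum_(h : endgrp y) catalg_coef u h *: grp_basis k h.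
Proof.
by rewrite {1}(grpalg_sum_basis (corner_y u)); apply: eq_bigr => h _; rewrite ffunE.
Qed.

(** On a fixed vector, [corner_xy] behaves like the off-diagonal entry of a
    product of triangular matrices. *)
Lemma corner_xyM u v : corner_xy (u * v) *: w =
  corner_y u *: (corner_xy v *: w) + (corner_x v)%:A *: (corner_xy u *: w).
Proof.
rewrite corner_xyE.
pose F (b : homset x y) := grp_basis k (lquot b) *: w.
pose T c (f : homset c y) (g : homset x c) :=
  (catalg_coef u f * catalg_coef v g)%:A *: F (compose f g).
transitivity (\sum_(c : C) \sum_(f : homset c y) \sum_(g : homset x c) T c f g).
  under eq_bigr => b _ do rewrite catalg_coefM scaler_suml scaler_suml.
  rewrite exchange_big; apply: eq_bigr => c _ /=.
  under eq_bigr => b _ do rewrite scaler_suml scaler_suml.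
  rewrite exchange_big; apply: eq_bigr => f _ /=.
  under eq_bigr => b _ do rewrite scaler_suml scaler_suml.
  rewrite exchange_big; apply: eq_bigr => g _ /=.
  rewrite /T.
  rewrite -(sum_delta
    (fun b => (catalg_coef u f * catalg_coef v g)%:A *: F b) (compose f g)).
  apply: eq_bigr => b _; case: eqP => _; first by rewrite mulr1.
  by rewrite mulr0 !scale0r.
rewrite sum_ob addrC; congr (_ + _).
  rewrite sum_endgrp corner_xyE corner_yE scaler_suml; apply: eq_bigr => f _.
  rewrite scaler_sumr; apply: eq_bigr => g _; rewrite /T.
  have -> : F (compose f g) = grp_basis k f *: F g.
    rewrite /F scalerA grp_basisM; apply: (@eq_on_rorbit _ _ 1%g).
    by rewrite lquotK -(composeA f) lquotK composem1.
  rewrite /F !scalerA; congr (_ *: w); rewrite -!scalerAl !mul1r.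
  by rewrite grpalg_scalerAr mulr1 -scalerAl scalerA mulrC.
rewrite corner_xyE scaler_sumr; apply: eq_bigr => f _.
rewrite /corner_x !scaler_suml; apply: eq_bigr => g _; rewrite /T.
have -> : F (compose f g) = F f by apply: (@eq_on_rorbit _ _ g); rewrite !lquotK.
rewrite -/(F f) [RHS]scalerA; congr (_ *: F f).
by rewrite -scalerAl mul1r scalerA mulrC.
Qed.

End Fixed.

Lemma coef_basis (a b : C) (f g : homset a b) :
  catalg_coef (catalg_basis k (to_mor g)) f = (f == g)%:R.
Proof. by rewrite catalg_coef_basis (inj_eq (@to_mor_inj _ _ _)). Qed.

Lemma coef_basis0 (a b a' b' : C) (f : homset a b) (g : homset a' b') :
  (a, b) != (a', b') -> catalg_coef (catalg_basis k (to_mor g)) f = 0.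
Proof.
move=> ne; rewrite catalg_coef_basis; case: eqP => // /(congr1 (@tag _ _)) /= e.
by rewrite e eqxx in ne.
Qed.

Lemma corner_x_basis0 (a b : C) (g : homset a b) :
  (x, x) != (a, b) -> corner_x (catalg_basis k (to_mor g)) = 0.
Proof. by move=> ne; apply: big1 => f _; apply: coef_basis0. Qed.

Lemma corner_y_basis0 (a b : C) (g : homset a b) :
  (y, y) != (a, b) -> corner_y (catalg_basis k (to_mor g)) = 0.
Proof. by move=> ne; apply/ffunP => f; rewrite !ffunE; apply: coef_basis0. Qed.

Lemma corner_xy_basis0 (a b : C) (g : homset a b) :
  (x, y) != (a, b) -> corner_xy (catalg_basis k (to_mor g)) = 0.
Proof. by move=> ne; apply: big1 => f _; rewrite coef_basis0 ?scale0r. Qed.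

Lemma corner_x_basis (g : homset x x) : corner_x (catalg_basis k (to_mor g)) = 1.
Proof.
rewrite -[RHS](sum_delta (fun=> 1) g); apply: eq_bigr => f _.
by rewrite coef_basis eq_sym.
Qed.

Lemma corner_y_basis (g : endgrp y) :
  corner_y (catalg_basis k (to_mor (g : homset y y))) = grp_basis k g.
Proof. by apply/ffunP => f; rewrite !ffunE coef_basis. Qed.

Lemma corner_xy_basis b : corner_xy (catalg_basis k (to_mor b)) = grp_basis k (lquot b).
Proof.
rewrite -[RHS](sum_delta (fun b => grp_basis k (lquot b)) b).
by apply: eq_bigr => f _; rewrite coef_basis eq_sym scaler_nat.
Qed.

Let xy_ne : (x == y) = false. Proof. exact: negbTE. Qed.
Let yx_ne : (y == x) = false. Proof. by rewrite eq_sym. Qed.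

Lemma catalg1 : 1 = catalg_basis k (to_mor (Defs.idm x)) + catalg_basis k (to_mor (Defs.idm y)).
Proof. exact: sum_ob. Qed.

Lemma corner_x1 : corner_x 1 = 1.
Proof.
by rewrite catalg1 corner_xD corner_x_basis corner_x_basis0 ?addr0 // xpair_eqE xy_ne.
Qed.

Lemma corner_y1 : corner_y 1 = 1.
Proof.
rewrite catalg1 corner_yD corner_y_basis0 ?add0r; last by rewrite xpair_eqE yx_ne.
by rewrite (corner_y_basis 1%g) grp_basis1.
Qed.

Lemma corner_xy1 : corner_xy 1 = 0.
Proof.
by rewrite catalg1 corner_xyD !corner_xy_basis0 ?addr0 // xpair_eqE ?yx_ne ?xy_ne ?andbF.
Qed.

(** The embedding of kH as a corner of the category algebra. *)
Definition inc_y (a : kH) : kC :=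
  \sum_(h : endgrp y) a h *: catalg_basis k (to_mor (h : homset y y)).

Lemma corner_y_inc a : corner_y (inc_y a) = a.
Proof.
rewrite [RHS]grpalg_sum_basis (big_morph _ corner_yD (id1 := 0)).
  by apply: eq_bigr => h _; rewrite corner_yZ corner_y_basis.
by apply: (addrI (corner_y 0)); rewrite -corner_yD !addr0.
Qed.

Section ExtensionModule.
Variables (W : lmodType kH) (n : nat).
Implicit Type w : 'I_n -> W.

Definition all_fixed w := forall i, fixed (rorbit_stab alpha) (w i).

Definition glue w u (c : 'rV[k]_n) : W :=
  \sum_i (c 0 i)%:A *: (corner_xy u *: w i).

(** The triangular matrix acts on a column: [glue] is the action of the
    off-diagonal entry, which sends the i-th basis vector to w_i. *)
Definition ext_scale w u (m : 'rV[k]_n * W) : 'rV[k]_n * W :=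
  (corner_x u *: m.1, corner_y u *: m.2 + glue w u m.1).

Lemma glueD w u c d : glue w u (c + d) = glue w u c + glue w u d.
Proof.
rewrite -big_split; apply: eq_bigr => i _ /=.
by rewrite mxE !scalerDl.
Qed.

Lemma glueDl w u v c : glue w (u + v) c = glue w u c + glue w v c.
Proof.
rewrite -big_split; apply: eq_bigr => i _ /=.
by rewrite corner_xyD scalerDl scalerDr.
Qed.

Lemma glue0 w u : glue w u 0 = 0.
Proof. by apply: big1 => i _; rewrite mxE !scale0r. Qed.

Lemma glueM w u v c : all_fixed w ->
  glue w (u * v) c = corner_y u *: glue w v c + glue w u (corner_x v *: c).
Proof.
move=> wf; rewrite scaler_sumr -big_split; apply: eq_bigr => i _ /=.
rewrite (corner_xyM (wf i)) scalerDr !scalerA grpalg_scalar_central; congr (_ + _).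
by rewrite !mxE -!scalerAl !mul1r -scalerAl mul1r scalerA mulrC.
Qed.

Variable w : 'I_n -> W.
Hypothesis wf : all_fixed w.

Fact ext_scalerA u v m : ext_scale w u (ext_scale w v m) = ext_scale w (u * v) m.
Proof.
rewrite /ext_scale /= corner_xM corner_yM glueM // scalerA scalerDr scalerA.
by rewrite addrA.
Qed.

Fact ext_scale1r : left_id 1 (ext_scale w).
Proof.
move=> [c z]; rewrite /ext_scale /= corner_x1 corner_y1 !scale1r /glue big1 ?addr0 //.
by move=> i _; rewrite corner_xy1 scale0r scaler0.
Qed.

Fact ext_scalerDr : right_distributive (ext_scale w) +%R.
Proof.
by move=> u [c z] [d t]; rewrite /ext_scale /= glueD !scalerDr addrACA.
Qed.

Fact ext_scalerDl m : {morph (ext_scale w)^~ m : u v / u + v}.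
Proof.
by move=> u v; rewrite /ext_scale corner_xD corner_yD glueDl !scalerDl addrACA.
Qed.

Definition ext_module : lmodType kC := HB.pack ('rV[k]_n * W)%type
  (GRing.Zmodule_isLmodule.Build kC ('rV[k]_n * W)%type
     ext_scalerA ext_scale1r ext_scalerDr ext_scalerDl).


Lemma ext_moduleE u (m : ext_module) :
  u *: m = (corner_x u *: m.1, corner_y u *: m.2 + glue w u m.1) :> ('rV[k]_n * W).
Proof. by []. Qed.

Lemma kdim_le_ext D : kdim_le (fun c : k => c%:A : kH) D W ->
  kdim_le (fun c : k => c *: (1 : kC)) (n + D) ext_module.
Proof.
move=> [g [gZ gS]].
have [|h hE] := @additive_pack 'rV[k]_(n + D) ext_module
    (fun r => (lsubmx r, g (rsubmx r))).
  by move=> u v /=; rewrite !raddfB.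
exists h; split=> [c v|[c z]]; last first.
  by have [v vE] := gS z; exists (row_mx c v); rewrite hE row_mxKl row_mxKr vE.
rewrite !hE ext_moduleE /= corner_xZ corner_yZ corner_x1 corner_y1 mulr1 /glue.
rewrite big1 => [|i _]; last by rewrite corner_xyZ corner_xy1 scaler0 scale0r scaler0.
by rewrite addr0 !linearZ /= gZ.
Qed.

End ExtensionModule.

(** The identities of x and y split an isomorphism into a matrix on k^n and a map
    U on W; compatibility with kH makes U linear, and compatibility with alpha
    is the stated relation. *)
Lemma ext_module_iso (W : lmodType kH) n (w w' : 'I_n -> W)
    (wf : all_fixed w) (wf' : all_fixed w') :
  isomorphic (ext_module wf) (ext_module wf') ->
  exists (U : {linear W -> W}) (a : 'M[k]_n), bijective U /\
    forall i, U (w i) = \sum_j (a i j)%:A *: w' j.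
Proof.
move=> [F /linear_inverse[G [FK GK]]].
have act_y (v : 'I_n -> W) (vf : all_fixed v) u c z : corner_x u = 0 -> corner_xy u = 0 ->
    u *: ((c, z) : ext_module vf) = (0, corner_y u *: z) :> ext_module vf.
  move=> u0 u1; rewrite ext_moduleE /= u0 scale0r /glue big1 ?addr0 // => i _.
  by rewrite u1 scale0r scaler0.
pose ex := catalg_basis k (to_mor (Defs.idm x)).
pose ey := catalg_basis k (to_mor (Defs.idm y)).
have ne1 : (x, x) != (y, y) by rewrite xpair_eqE xy_ne.
have ne2 : (x, y) != (y, y) by rewrite xpair_eqE xy_ne.
have ne3 : (x, y) != (x, x) by rewrite xpair_eqE yx_ne andbF.
have ne4 : (y, y) != (x, x) by rewrite xpair_eqE yx_ne.
have eyE : corner_y ey = 1 by rewrite (corner_y_basis 1%g) grp_basis1.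
have ey_act (v : 'I_n -> W) (vf : all_fixed v) (m : ext_module vf) :
    ey *: m = (0, m.2) :> ext_module vf.
  case: m => c z; rewrite act_y ?eyE ?scale1r //.
    exact: corner_x_basis0.
  exact: corner_xy_basis0.
have ex_act (v : 'I_n -> W) (vf : all_fixed v) (m : ext_module vf) :
    ex *: m = (m.1, 0) :> ext_module vf.
  rewrite ext_moduleE corner_x_basis corner_y_basis0 // scale1r scale0r add0r.
  by rewrite /glue big1 // => i _; rewrite corner_xy_basis0 // scale0r scaler0.
pose iy (v : 'I_n -> W) (vf : all_fixed v) z : ext_module vf := (0, z).
have iy_ey (v : 'I_n -> W) (vf : all_fixed v) z : iy v vf z = ey *: iy v vf z.
  by rewrite ey_act.
have Fy z : F (iy w wf z) = iy w' wf' (F (iy w wf z)).2.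
  by rewrite {1}iy_ey linearZ; apply: ey_act.
have Gy z : G (iy w' wf' z) = iy w wf (G (iy w' wf' z)).2.
  by rewrite {1}iy_ey linearZ; apply: ey_act.
have iyE (v : 'I_n -> W) (vf : all_fixed v) a z t :
    iy v vf (a *: z + t) = (inc_y a * ey) *: iy v vf z + iy v vf t.
  rewrite -scalerA -iy_ey.
  have -> : inc_y a *: iy v vf z = ((corner_x (inc_y a) *: 0 : 'rV[k]_n),
     a *: z + glue v (inc_y a) 0).
    by rewrite -[X in X *: z](corner_y_inc a).
  by rewrite glue0 scaler0 addr0 /iy; congr (_, _); rewrite addr0.
have inc_act a (m : ext_module wf') : ((inc_y a * ey) *: m).2 = a *: m.2.
  by rewrite -scalerA ey_act /= glue0 addr0 corner_y_inc.
have [|U UE] := @linear_pack _ W W (fun z => (F (iy w wf z)).2).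
  by move=> a z t; rewrite iyE linearP -inc_act.

pose A := \matrix_(i, j) (F ((delta_mx 0 i, 0) : ext_module wf)).1 0 j.
exists U, A; split.
  exists (fun z => (G (iy w' wf' z)).2) => z; rewrite UE.
    by rewrite -Fy FK.
  by rewrite -Gy GK.
move=> i; pose ea := catalg_basis k (to_mor alpha).
have ea_act (v : 'I_n -> W) (vf : all_fixed v) (m : ext_module vf) :
    ea *: m = iy v vf (\sum_j (m.1 0 j)%:A *: v j).
  rewrite ext_moduleE corner_x_basis0; last by rewrite xpair_eqE xy_ne andbF.
  rewrite corner_y_basis0; last by rewrite xpair_eqE yx_ne.
  rewrite !scale0r add0r /glue /iy; congr (_, _); apply: eq_bigr => j _.
  rewrite corner_xy_basis (@eq_on_rorbit _ _ (vf j) _ 1%g 1%g) ?lquotK.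
    by rewrite grp_basis1 scale1r.
  by rewrite (compose1m alpha) (composem1 alpha).
have wE : iy w wf (w i) = ea *: ((delta_mx 0 i, 0) : ext_module wf).
  rewrite ea_act /=; congr (iy w wf _).
  rewrite -[LHS](sum_delta w i); apply: eq_bigr => j _.
  by rewrite mxE eqxx eq_sym /=; case: eqP => _; rewrite ?mulr1n ?scale1r ?scale0r.
have FE m : F (ea *: m) = iy w' wf' (\sum_j ((F m).1 0 j)%:A *: w' j).
  by rewrite linearZ; apply: ea_act.
by rewrite UE wE FE /=; apply: eq_bigr => j _; rewrite mxE.
Qed.

(** The labels are the isomorphism classes of the modules [ext_module w]. *)
Lemma extension_classification (W : lmodType kH) n D :
  finite_representation_type kC -> kdim_le (fun c : k => c%:A : kH) D W ->
  exists (I : finType) (Q : ('I_n.+1 -> W) -> I -> Prop),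
    (forall w, all_fixed w -> exists i, Q w i) /\
    forall w w' i, Q w i -> Q w' i ->
      exists (U : {linear W -> W}) (a : 'M[k]_n.+1), bijective U /\
        forall i, U (w i) = \sum_j (a i j)%:A *: w' j.
Proof.
move=> frt Wd.
have [I [R RP]] := finite_iso_classes (fun c : k => c *: (1 : kC)) (n.+1 + D) frt.
exists I, (fun w i => exists wf : all_fixed w, isomorphic (ext_module wf) (R i)).
split=> [w wf|w w' i [wf E] [wf' E']].
  have [|i iP] := RP (ext_module wf) _ (kdim_le_ext wf Wd); last by exists i, wf.
  exists (delta_mx 0 ord0, 0); apply/eqP => /(congr1 fst) /= /rowP /(_ ord0).
  by rewrite !mxE eqxx; apply/eqP/oner_neq0.
exact: ext_module_iso (isomorphic_trans E (isomorphic_sym E')).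
Qed.

End Extension.

(** * The induced module *)

Section Induced.
Variables (k : fieldType) (gT : finGroupType) (H : {group gT}).
Local Notation kG := (grpalg k gT).
Local Notation kH := (grpalg k (subg_of H)).

Lemma grpalg_incl_sum (b : kH) :
  grpalg_incl H b = \sum_s b s *: grp_basis k (sgval s).
Proof.
apply/ffunP => g; rewrite ffunE sum_ffunE big_mkcond; apply: eq_bigr => s _.
by rewrite !ffunE eq_sym /GRing.scale /=; case: eqP => _; rewrite ?mulr1 ?mulr0.
Qed.

Lemma incl_fixed (W : lmodType kG) (w : W) b : fixed H w ->
  grpalg_incl H b *: w = (augmentation b)%:A *: w.
Proof.
move=> wf; rewrite grpalg_incl_sum /augmentation !scaler_suml.
apply: eq_bigr => s _.
by rewrite -(mul1r (grp_basis k _)) scalerAl -scalerA wf ?subgP.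
Qed.

Section Tensor.
Variables (V : lmodType kG) (t : kG -> trivmod k (subg_of H) -> V).
Hypothesis tP : is_tensor (grpalg_incl H) t.

Lemma tensor_ext (Z : zmodType) (f g : {additive V -> Z}) :
  (forall a c, f (t a c) = g (t a c)) -> f =1 g.
Proof.
move=> fg; case: tP => -[tDl tDr tb] _ univ.
have [|u [uE uU]] := univ Z (fun a c => f (t a c)).
  split=> [a a' c|a c c'|a b c]; rewrite ?tDl ?tDr ?raddfD //.
  by rewrite tb.
by move=> v; rewrite (uU f) // (uU g).
Qed.

(** Both sides of a *: f u = f (a *: u) are additive in u and agree on tensors. *)
Lemma tensor_linear_ext (W : lmodType kG) (f : {additive V -> W}) :
  (forall a b c, f (t (a * b) c) = a *: f (t b c)) -> linear f.
Proof.
case: tP => _ tA _ fA a u v; rewrite raddfD; congr (_ + _).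
have [|f1 f1E] := @additive_pack V W (fun u => f (a *: u)).
  by move=> r s /=; rewrite scalerBr raddfB.
have [|f2 f2E] := @additive_pack V W (fun u => a *: f u).
  by move=> r s /=; rewrite raddfB scalerBr.
rewrite -f1E -f2E; apply: tensor_ext => b c.
by rewrite f1E f2E -tA fA.
Qed.

Definition generator : V := t 1 (1 : k).

(** Frobenius reciprocity: an H-fixed vector of W is a homomorphism from the
    trivial module to W. *)
Lemma tensor_lift (W : lmodType kG) (w : W) : fixed H w ->
  exists f : {linear V -> W}, f generator = w /\
    forall a c, f (t a c) = ((c : k) *: a) *: w.
Proof.
move=> wf; case: (tP) => _ tA univ.
have [|f [fE _]] := univ W (fun a c => ((c : k) *: a) *: w).
  split=> [a a' c|a c c'|a b c]; rewrite ?scalerDr ?scalerDl //.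
  rewrite scalerAl -scalerA incl_fixed // [in RHS]/GRing.scale /= /trivmod_scale.
  rewrite scalerA grpalg_scalerAr mulr1 scalerA //.
have fA a b c : f (t (a * b) c) = a *: f (t b c).
  by rewrite !fE -grpalg_scalerAr scalerA.
have [F FE] := linear_pack (tensor_linear_ext fA).
exists F; split=> [|a c]; last by rewrite FE fE.
by rewrite FE fE scale1r scale1r.
Qed.

Local Notation model := (submodule (@coset_constant k gT H)).
Local Notation mt := (@model_tensor k gT H).

Lemma tensor_iso_model : exists f : {linear V -> model},
  bijective f /\ forall a c, f (t a c) = mt a c.
Proof.
case: (tP) => tb tA univ; case: (@model_is_tensor k gT H) => mb mA muniv.
have [f [fE _]] := univ _ mt mb.
have [g [gE _]] := muniv _ t tb.
have fA a b c : f (t (a * b) c) = a *: f (t b c) by rewrite !fE mA.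
have [F FE] := linear_pack (tensor_linear_ext fA).
exists F; split=> [|a c]; last by rewrite FE.
exists g => v; rewrite FE.
  have [|gf gfE] := @additive_pack V V (g \o f); first by move=> r s /=; rewrite !raddfB.
  by rewrite -[LHS]gfE; apply: (@tensor_ext _ gf idfun) => a c; rewrite gfE /= fE gE.
rewrite (model_gen_span v) !raddf_sum; apply: eq_bigr => h _.
by rewrite /= gE fE.
Qed.

Lemma tensorE a (c : k) : t a c = (c *: a) *: generator.
Proof.
case: (tP) => -[_ _ tb] tA _; rewrite /generator -tA mulr1.
have incl_c : grpalg_incl H (c *: 1) = c *: 1.
  transitivity (c *: grpalg_incl H 1); last by rewrite rmorph1.
  by apply/ffunP => g; rewrite !ffunE scaler_sumr; apply: eq_bigr => s _; rewrite ffunE.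
have aug_c : augmentation (c *: (1 : kH)) = c.
  rewrite -[RHS]mulr1 -(rmorph1 (@augmentation k (subg_of H))) /augmentation mulr_sumr.
  by apply: eq_bigr => s _; rewrite ffunE.
have -> : c *: a = a * grpalg_incl H (c *: 1).
  by rewrite incl_c grpalg_scalerAr mulr1.
rewrite tb; congr (t a _).
by rewrite /GRing.scale /= /trivmod_scale aug_c mulr1.
Qed.

Lemma generator_cyclic v : exists a, v = a *: generator.
Proof.
have [f [[g fK gK] fE]] := tensor_iso_model.
exists (\sum_(h | is_repr H h) (val (f v) : kG) h *: grp_basis k h).
rewrite scaler_suml; apply: (can_inj fK); rewrite raddf_sum [LHS](model_gen_span (f v)).
by apply: eq_bigr => h _; rewrite -tensorE; apply/esym/fE.
Qed.

Lemma generator_fixed : fixed H generator.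
Proof.
move=> h hH; case: (tP) => -[_ _ tb] tA _; rewrite /generator -tA mulr1.
have hE : grp_basis k h = 1 * grpalg_incl H (grp_basis k (subg H h)).
  rewrite mul1r grpalg_incl_sum.
  transitivity (grp_basis k (sgval (subg H h))); first by rewrite subgK.
  rewrite -[LHS](sum_delta (fun s => grp_basis k (sgval s)) (subg H h)).
  by apply: eq_bigr => s _; rewrite ffunE scaler_nat eq_sym.
rewrite hE tb; congr (t 1 _).
rewrite /GRing.scale /= /trivmod_scale mulr1 /augmentation.
rewrite -[RHS](sum_delta (fun=> 1) (subg H h)); apply: eq_bigr => s _.
by rewrite ffunE eq_sym.
Qed.

Lemma kdim_le_induced : kdim_le (fun c : k => c%:A : kG) #|gT| V.
Proof.
have [|g gE] := @additive_pack 'rV[k]_#|gT| V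
    (fun v => (\sum_i v 0 i *: grp_basis k (enum_val i)) *: generator).
  move=> u v /=; rewrite -scalerBl -sumrB; congr (_ *: _); apply: eq_bigr => i _.
  by rewrite !mxE scalerBl.
exists g; split=> [c v|m].
  rewrite !gE scalerA -scalerAl mul1r scaler_sumr; congr (_ *: _).
  by apply: eq_bigr => i _; rewrite mxE scalerA.
have [a ->] := generator_cyclic m; exists (\row_i a (enum_val i)).
rewrite gE {2}(grpalg_sum_basis a) [in RHS](reindex_onto enum_val enum_rank) /=; last first.
  by move=> h _; rewrite enum_rankK.
by congr (_ *: _); apply: eq_big => [i|i _]; rewrite ?mxE // enum_valK eqxx.
Qed.

Local Notation dcoset g := ((H :* g) * H)%g.

Lemma dcosetP g h :
  reflect (exists a b, [/\ a \in H, b \in H & h = (a * g * b)%g]) (h \in dcoset g).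
Proof.
apply: (iffP mulsgP) => [[_ b /rcosetP[a aH ->] bH ->]|[a [b [aH bH ->]]]].
  by exists a, b.
by exists (a * g)%g b; rewrite ?mem_rcoset ?mulgK.
Qed.

Lemma dcoset_eq g h : h \in dcoset g -> dcoset h = dcoset g.
Proof.
move=> /dcosetP[a [b [aH bH ->]]]; apply/setP => l; apply/dcosetP/dcosetP.
  move=> [c [d [cH dH ->]]]; exists (c * a)%g, (b * d)%g.
  by rewrite !groupM // !mulgA.
move=> [c [d [cH dH ->]]]; exists (c * a^-1)%g, (b^-1 * d)%g.
by rewrite !groupM ?groupV // !mulgA mulgKV mulgK.
Qed.

Lemma mem_dcoset g : g \in dcoset g.
Proof. by apply/dcosetP; exists 1%g, 1%g; rewrite group1 mul1g mulg1. Qed.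

Lemma mem_double_coset (d : {set gT}) h : d \in double_cosets H ->
  (h \in d) = (dcoset h == d).
Proof.
move=> /imsetP[g _ ->]; apply/idP/eqP => [|<-]; first exact: dcoset_eq.
exact: mem_dcoset.
Qed.

Lemma dcosetM g a b : a \in H -> b \in H -> dcoset (a * g * b) = dcoset g.
Proof. by move=> aH bH; apply: dcoset_eq; apply/dcosetP; exists a, b. Qed.

Lemma model_valZ a (w : model) : val (a *: w) = a * (val w : kG).
Proof.
have E : val (a *: w) = a *: (val w : kG^o) by rewrite linearZ.
exact: E.
Qed.

(** An endomorphism is determined by the image of the generator.  In the model by
    functions on the group this image is right H-invariant, and it is left
    H-invariant because it is fixed; so the indicators of the double cosets give
    a basis. *)
Lemma hom_dim_induced : hom_dim V V #|double_cosets H|.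
Proof.
have [psi [psib _]] := tensor_iso_model.
have [psi' [psiK psiK']] := linear_inverse psib.
pose D := double_cosets H.
pose d (i : 'I_#|D|) := enum_val i.
have dD i : d i \in D by apply: enum_valP.
pose ind i : kG := [ffun h => (h \in d i)%:R].
have indc i : ind i \in coset_constant H.
  apply/coset_constantP => g h hH; rewrite !ffunE !(mem_double_coset _ (dD i)).
  by rewrite -{1}(mul1g g) dcosetM.
pose m i : model := Sub (ind i) (indc i).
have basisE (g h : gT) (u : kG) : (grp_basis k g * u) h = u (g^-1 * h)%g.
  rewrite ffunE (bigD1 g) //= big1 ?addr0 ?ffunE ?eqxx ?mul1r // => l lg.
  by rewrite ffunE (negbTE lg) mul0r.
have mfix i : fixed H (psi' (m i)).
  move=> g gH; transitivity (psi' (grp_basis k g *: m i)); first by rewrite linearZ.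
  congr (psi' _); apply/val_inj/ffunP => h.
  rewrite model_valZ basisE !ffunE !(mem_double_coset _ (dD i)).
  by rewrite -[(g^-1 * h)%g]mulg1 dcosetM ?groupV.
have /choice[e eE] i : exists e : {linear V -> V}, e generator = psi' (m i).
  by have [e [eE _]] := tensor_lift (mfix i); exists e.
have combE (c : 'I_#|D| -> k) h :
    (val (psi (\sum_i (c i)%:A *: e i generator)) : kG) h = \sum_i c i * (h \in d i)%:R.
  rewrite linear_sum raddf_sum sum_ffunE; apply: eq_bigr => i _.
  rewrite linearZ_LR -[LHS]/((val ((c i)%:A *: psi (e i generator)) : kG) h).
  by rewrite model_valZ -scalerAl mul1r ffunE eE psiK' /= ffunE.
have comb_at (c : 'I_#|D| -> k) h i : h \in d i -> \sum_i c i * (h \in d i)%:R = c i.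
  move=> hi; rewrite (bigD1 i) //= hi mulr1 big1 ?addr0 // => j ji.
  move: hi; rewrite !(mem_double_coset _ (dD _)) => /eqP->.
  by rewrite (inj_eq enum_val_inj) eq_sym (negbTE ji) mulr0.
have rep i : exists g, g \in d i.
  have /imsetP[g _ dE] := dD i; exists g; rewrite dE; exact: mem_dcoset.
exists e => f; pose u : kG := val (psi (f generator)).
(* [u] is the image of the generator, as a function on the group. *)
have uL g h : g \in H -> u (g * h)%g = u h.
  move=> gH; rewrite -[g]invgK -basisE /u.
  by rewrite -model_valZ -!linearZ_LR generator_fixed ?groupV.
have uR := coset_constantP _ _ (valP (psi (f generator))).
have u_dc g h : dcoset g = dcoset h -> u g = u h.
  move=> E; have := mem_dcoset g; rewrite E => /dcosetP[a [b [aH bH ->]]].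
  by rewrite -mulgA uL // /u uR.
exists [ffun i => u (xchoose (rep i))]; split=> [v|c cE]; last first.
  apply/ffunP => i; rewrite ffunE /u (cE generator) combE.
  exact: comb_at (xchooseP (rep i)).
have fgen : f generator = \sum_i (u (xchoose (rep i)))%:A *: e i generator.
  apply: (can_inj psiK); apply/val_inj/ffunP => h; rewrite combE.
  have hD : dcoset h \in D by apply: imset_f.
  pose i := enum_rank_in hD (dcoset h).
  have di : d i = dcoset h by rewrite /d enum_rankK_in.
  rewrite (comb_at _ _ i) ?di ?mem_dcoset //; apply: u_dc.
  by apply/esym/dcoset_eq; rewrite -di; apply: (xchooseP (rep i)).
have [a ->] := generator_cyclic v; rewrite linearZ /= fgen scaler_sumr.
apply: eq_bigr => i _; rewrite ffunE linearZ /= !scalerA.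
by rewrite grpalg_scalar_central.
Qed.

End Tensor.
End Induced.

(** * Splittings *)

Section ModuleFacts.
Variables (A : pzRingType).
Implicit Types M N : lmodType A.

(** The kernel of f and the image of g are complementary, and the image is not
    zero. *)
Lemma split_epi_iso M N (f : {linear M -> N}) (g : {linear N -> M}) :
  cancel g f -> indecomposable M -> nontrivial N -> isomorphic M N.
Proof.
move=> gK [_ Mi] [n n0].
have [S SE] : exists S : submodClosed M, forall m, m \in S <-> f m = 0.
  by apply: submod_pack => [|a u v fu fv]; rewrite ?linear0 // linearP fu fv scaler0 addr0.
have [T TE] : exists T : submodClosed M, forall m, m \in T <-> exists l, m = g l.
  apply: submod_pack => [|a u v [u' ->] [v' ->]]; first by exists 0; rewrite linear0.
  by exists (a *: u' + v'); rewrite linearP.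
have ST : complementary S T.
  split=> [m|m /SE fm /TE[l mE]]; last by move: fm; rewrite mE gK => ->; rewrite linear0.
  exists (m - g (f m)), (g (f m)); rewrite subrK; split=> //.
    by apply/SE; rewrite linearB gK subrr.
  by apply/TE; exists (f m).
have [S0|T0] := Mi S T ST; last first.
  case/eqP: n0; rewrite -(gK n) (T0 (g n)) ?linear0 //; apply/TE; by exists n.
exists f; exists g => // m; apply/esym/eqP; rewrite -subr_eq0; apply/eqP/S0/SE.
by rewrite linearB gK subrr.
Qed.

Lemma direct_sum_projection M n (S : 'I_n -> submodClosed M) : direct_sum S ->
  exists p : forall i, {linear M -> submodule (S i)},
    (forall i (s : submodule (S i)), p i (val s) = s) /\
    (forall i j (s : submodule (S j)), i != j -> p i (val s) = 0).
Proof.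
move=> dS.
have /choice[s sP] m : exists s : {ffun 'I_n -> M},
    (forall i, s i \in S i) /\ m = \sum_(i < n) s i.
  by have [s [sP _]] := dS m; exists s.
have sU m (r : {ffun 'I_n -> M}) : (forall i, r i \in S i) -> m = \sum_(i < n) r i -> s m = r.
  move=> rS mE; have [s0 [_ s0U]] := dS m.
  by rewrite -(s0U _ (sP m)); apply: s0U.
have sL a u v : s (a *: u + v) = [ffun i => a *: s u i + s v i].
  apply: sU => [i|]; first by rewrite ffunE rpredD ?rpredZ ?(sP _).1.
  rewrite {1}(sP u).2 {1}(sP v).2 scaler_sumr -big_split.
  by apply: eq_bigr => i _; rewrite ffunE.
have sE i (m : submodule (S i)) : s (val m) = [ffun j => if j == i then val m else 0].
  apply: sU => [j|]; first by rewrite ffunE; case: eqP => [->|_]; [exact: valP | exact: rpred0].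
  rewrite (bigD1 i) //= ffunE eqxx big1 ?addr0 // => j ji.
  by rewrite ffunE (negbTE ji).
have pE i : exists f : {linear M -> submodule (S i)}, forall m, val (f m) = s m i.
  have [|f fE] := @linear_pack A M (submodule (S i)) (fun m => Sub (s m i) ((sP m).1 i)).
    by move=> a u v; apply/val_inj; rewrite /= sL ffunE.
  by exists f => m; rewrite fE.
exists (fun i => projT1 (cid (pE i))); split=> [i r|i j r ij];
  apply/val_inj; rewrite (projT2 (cid (pE i))) sE ffunE ?eqxx //.
by rewrite (negbTE ij).
Qed.
End ModuleFacts.

(** * The three conclusions *)

Section Conclusions.
Variables (k : closedFieldType) (gT : finGroupType) (H : {group gT}).
Local Notation kG := (grpalg k gT).
Local Notation kscal := (fun c : k => c%:A : kG).

(** The consequence of finite representation type that the proof uses: tuples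
    of fixed vectors get finitely many labels, and tuples with the same label
    are related by an automorphism of [W] and a linear substitution. *)
Definition finitely_many_extensions := forall (W : lmodType kG) n D,
  kdim_le kscal D W ->
  exists (I : finType) (Q : ('I_n.+1 -> W) -> I -> Prop),
    (forall w, (forall i, fixed H (w i)) -> exists i, Q w i) /\
    forall w w' i, Q w i -> Q w' i ->
      exists (U : {linear W -> W}) (a : 'M[k]_n.+1), bijective U /\
        forall i, U (w i) = \sum_j (a i j)%:A *: w' j.

Hypothesis fin : finitely_many_extensions.
Variables (V : lmodType kG) (t : kG -> trivmod k (subg_of H) -> V).
Hypothesis tP : is_tensor (grpalg_incl H) t.
Local Notation gen := (generator t).

Lemma kscalAA (W : lmodType kG) (c d : k) (w : W) :
  c%:A *: (d%:A *: w) = (c * d)%:A *: w.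
Proof. by rewrite scalerA -scalerAl mul1r scalerA. Qed.

Lemma kscalC (W : lmodType kG) (c : k) (a : kG) (w : W) :
  a *: (c%:A *: w) = c%:A *: (a *: w).
Proof. by rewrite !scalerA grpalg_scalar_central. Qed.

Lemma kscal_eq0 (W : lmodType kG) (c : k) (w : W) : c%:A *: w = 0 -> w != 0 -> c = 0.
Proof.
move=> cw w0; apply/eqP; apply: contra_neqT w0 => c0.
have := congr1 (fun w => c^-1%:A *: w) cw.
by rewrite /= kscalAA mulVf // scaler0 !scale1r.
Qed.

Lemma hom_fixed (W : lmodType kG) (f : {linear V -> W}) : fixed H (f gen).
Proof. by move=> h hH; rewrite -linearZ (generator_fixed tP). Qed.

Lemma eq_on_generator (W : lmodType kG) (f g : {linear V -> W}) :
  f gen = g gen -> f =1 g.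
Proof. by move=> E v; have [a ->] := generator_cyclic tP v; rewrite !linearZ /= E. Qed.

(** Two members of a line in Hom(V, W) have the same label.  For tuples of length
    one the linear substitution is a single scalar c. *)
Lemma pencil (W : lmodType kG) D (phi psi : {linear V -> W}) : kdim_le kscal D W ->
  exists s r c : k, exists U : {linear W -> W}, [/\ s != r, bijective U &
    forall v, U (s%:A *: phi v + psi v) = c%:A *: (r%:A *: phi v + psi v)].
Proof.
move=> Wd; have [I [Q [Qex Qeq]]] := fin 0 Wd.
have lin s : linear (fun v => s%:A *: phi v + psi v).
  by move=> a u v; rewrite !linearP /= !scalerDr !kscalC addrACA.
have [|s [r [i [sr Qs Qr]]]] :=
    @closed_field_pigeonhole k I (fun s i => Q (fun=> s%:A *: phi gen + psi gen) i).
  move=> s; apply: Qex => _; have [f fE] := linear_pack (lin s).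
  by rewrite -fE; apply: hom_fixed.
have [U [a [Ub UE]]] := Qeq _ _ _ Qs Qr.
exists s, r, (a ord0 ord0), U; split=> // v.
have [b ->] := generator_cyclic tP v.
have := UE ord0; rewrite big_ord_recl big_ord0 addr0 => E.
have bE l : l%:A *: phi (b *: gen) + psi (b *: gen) = b *: (l%:A *: phi gen + psi gen).
  by rewrite !linearZ /= scalerDr kscalC.
by rewrite !bE linearZ /= E kscalC.
Qed.

Lemma kscal_inj (W : lmodType kG) (c d : k) (w : W) :
  w != 0 -> c%:A *: w = d%:A *: w -> c = d.
Proof.
move=> w0 /eqP; rewrite -subr_eq0 -scalerBl -scalerBl => /eqP/kscal_eq0/(_ w0)/eqP.
by rewrite subr_eq0 => /eqP.
Qed.

(** With W = S_j, psi the projection to S_j and phi the projection to a summand S_i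
    isomorphic to S_j, [pencil] gives U = c on W from psi, and then s c = c r from phi. *)
Lemma top_summands_distinct : simple_summands_distinct (Top V).
Proof.
move=> n S dS i j ij [[z z0] _] _ [g [g' gK g'K]].
have [p [pK p0]] := direct_sum_projection dS.
pose q : {linear V -> Top V} := @quotmod_proj kG V (@radical kG V).
have qS u : exists v, q v = u by exact: quotmod_proj_surj.
have [|phi phiE] := @linear_pack _ V (submodule (S j)) (g \o p i \o q).
  by move=> a u v; rewrite /= !linearP.
have [|psi psiE] := @linear_pack _ V (submodule (S j)) (p j \o q).
  by move=> a u v; rewrite /= !linearP.
have Sd : kdim_le kscal #|gT| (submodule (S j)).
  apply: (kdim_le_surj (f := psi)) (kdim_le_induced tP) => s.
  by have [v qv] := qS (val s); exists v; rewrite psiE /= qv pK.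
have [s [r [c [U [sr Ub UE]]]]] := pencil phi psi Sd.
pose w := g z.
have w0 : w != 0 by apply: contraNneq z0 => w0; rewrite -(gK z) -/w w0 -(gK 0) linear0.
have U1 : U w = c%:A *: w.
  have [v qv] := qS (val w); have := UE v.
  by rewrite phiE psiE /= qv p0 // pK linear0 !scaler0 !add0r.
have U2 : (s * c)%:A *: w = (c * r)%:A *: w.
  have [v qv] := qS (val z); have := UE v.
  rewrite phiE psiE /= qv pK p0 1?eq_sym // !addr0 linearZ /= -/w U1.
  by rewrite !kscalAA.
have c0 : c != 0.
  apply: contraNneq w0 => c0; apply/eqP/(bij_inj Ub).
  by rewrite U1 c0 !scale0r linear0.
have := kscal_inj w0 U2; rewrite [RHS]mulrC => /(mulIf c0) /eqP.
by rewrite (negbTE sr).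
Qed.

(** Let tau : M -> N and sig : N -> M be inclusions followed by projections, and
    r = f sig, e = sig tau.  If r or e were bijective, M and N would be
    isomorphic, so both are nilpotent.  The relation of [pencil] for
    phi = f pr_M and psi = pr_N, restricted to N and to M, says that
    K = s U - c l satisfies K (r n) = (c - U) n and K (f m) = (c - U) (tau m).
    Since K (1 + s r) = c (s - l) is injective and 1 + s r is invertible, K is
    injective.  Hence f = r tau = f e, and f = f e^i = 0 for large i. *)
Lemma summand_hom0 (M N : submodClosed V) :
  direct_summand M -> direct_summand N ->
  indecomposable (submodule M) -> indecomposable (submodule N) ->
  ~ isomorphic (submodule M) (submodule N) ->
  forall f : {linear submodule M -> submodule N}, forall m, f m = 0.
Proof.
move=> Ms Ns Mi Ni MN f.
have [pM pMK] := direct_summand_projection Ms.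
have [pN pNK] := direct_summand_projection Ns.
have Md : kdim_le kscal #|gT| (submodule M).
  by apply: (kdim_le_surj (f := pM)) (kdim_le_induced tP) => m; exists (val m).
have Nd : kdim_le kscal #|gT| (submodule N).
  by apply: (kdim_le_surj (f := pN)) (kdim_le_induced tP) => m; exists (val m).
have [|tau tauE] := @linear_pack _ (submodule M) (submodule N) (pN \o val).
  by move=> a u v; rewrite /= linearP.
have [|sig sigE] := @linear_pack _ (submodule N) (submodule M) (pM \o val).
  by move=> a u v; rewrite /= linearP.
have [|phi phiE] := @linear_pack _ V (submodule N) (f \o pM).
  by move=> a u v; rewrite /= !linearP.
have [|r rE] := @linear_pack _ (submodule N) (submodule N) (f \o sig).
  by move=> a u v; rewrite /= !linearP.
have [|e eE] := @linear_pack _ (submodule M) (submodule M) (sig \o tau).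
  by move=> a u v; rewrite /= !linearP.
have [rb|[ri riE]] := fitting r Nd Ni.
  have [r' [rK r'K]] := linear_inverse rb.
  have [|g gE] := @linear_pack _ (submodule N) (submodule M) (sig \o r').
    by move=> a u v; rewrite /= !linearP.
  case: MN; apply: (@split_epi_iso _ _ _ f g) Mi Ni.1 => n.
  by rewrite gE -[RHS]r'K rE.
have [eb|[ei eiE]] := fitting e Md Mi.
  have [e' [eK e'K]] := linear_inverse eb.
  have [|g gE] := @linear_pack _ (submodule M) (submodule N) (tau \o e').
    by move=> a u v; rewrite /= !linearP.
  case: MN; apply: isomorphic_sym; apply: (@split_epi_iso _ _ _ sig g) Ni Mi.1 => n.
  by rewrite gE -[RHS]e'K eE.
have [s [l [c [U [sl Ub UE]]]]] := pencil phi pN Nd.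
have UN n : U (s%:A *: r n + n) = c%:A *: (l%:A *: r n + n).
  by have := UE (val n); rewrite phiE /= pNK rE /= sigE.
have UM m : U (s%:A *: f m + tau m) = c%:A *: (l%:A *: f m + tau m).
  by have := UE (val m); rewrite phiE /= pMK tauE.
(* 1 + d r is unipotent, hence invertible. *)
have unip d : exists2 R : {linear submodule N -> submodule N},
    bijective R & forall n, R n = d%:A *: r n + n.
  have [|R RE] := @linear_pack _ (submodule N) (submodule N) (fun n => d%:A *: r n + n).
    by move=> a u v; rewrite linearP /= !scalerDr kscalC addrACA.
  exists R => //; have [//|[i iP]] := fitting R Nd Ni.
  have Rinj n : R n = 0 -> n = 0.
    move=> /eqP; rewrite RE addr_eq0 => /eqP rn.
    have it j : n = ((- d) ^+ j)%:A *: iter j r n.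
      elim: j => [|j IH]; first by rewrite expr0 !scale1r.
      have nE : n = (- d)%:A *: r n by rewrite !scaleNr rn opprK.
      by rewrite {1}nE {1}IH linearZ /= kscalAA -exprS.
    by rewrite (it ri) riE scaler0.
  have it0 j n : iter j R n = 0 -> n = 0 by elim: j => //= j IH /Rinj.
  by case: (Ni.1) => n /eqP[]; apply: it0 (iP n).
have [R [R' RK R'K] RE] := unip s.
have c0 : c != 0.
  apply/eqP => c0; case: (Ni.1) => n /eqP[]; apply: (can_inj RK); apply: (bij_inj Ub).
  by rewrite RE UN c0 !scale0r linear0 linear0.
have [|K KE] := @linear_pack _ (submodule N) (submodule N)
    (fun n => s%:A *: U n - (c * l)%:A *: n).
  by move=> a u v; rewrite linearP /= !scalerDr scalerN !kscalC opprD addrACA.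
have KR n : K (R n) = (c * (s - l))%:A *: n.
  rewrite KE RE UN !scalerDr !kscalAA opprD addrACA -!scalerBl.
  rewrite [X in X%:A *: r n](_ : _ = 0); last by ring.
  by rewrite !scale0r add0r; congr (_%:A *: n); ring.
have Kinj n : K n = 0 -> n = 0.
  rewrite -[n]R'K KR => Kn; apply/eqP; apply: contraT => n0; move: Kn => /kscal_eq0.
  have n1 : R' n != 0 by apply: contraNneq n0 => ->; rewrite linear0.
  by move=> /(_ n1)/eqP; rewrite mulf_eq0 (negbTE c0) subr_eq0 (negbTE sl).
have KU u v : U (s%:A *: u + v) = c%:A *: (l%:A *: u + v) -> K u = c%:A *: v - U v.
  rewrite linearD linearZ /= scalerDr kscalAA KE => E.
  have -> : s%:A *: U u = (c * l)%:A *: u + c%:A *: v - U v by rewrite -E addrK.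
  by rewrite addrAC [_ + c%:A *: v]addrC addrK.
have fer m : f m = f (e m).
  apply/eqP; rewrite -subr_eq0; apply/eqP/Kinj; rewrite linearB (KU _ _ (UM m)).
  have -> : f (e m) = r (tau m) by rewrite rE eE.
  by rewrite (KU _ _ (UN (tau m))) subrr.
move=> m; have : forall j, f m = f (iter j e m).
  by elim=> //= j IH; rewrite -fer.
by move/(_ ei); rewrite eiE linear0.
Qed.


(** Realize End(V) as a matrix algebra and label x by the class of the pair
    (v, x v), with v the generator.  If the pairs of x and z are related by U,
    then U v = a v + b z v and U x v = c v + d z v, and so, as v generates V,
    U = a + b z and U x = c + d z: the hypotheses of [mobius_finite_rank]. *)
Lemma hom_dim_le3 d : hom_dim V V d -> (d <= 3)%N.
Proof.
move=> [e eP].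
have e_free (c : 'I_d -> k) : (forall v, \sum_i (c i)%:A *: e i v = 0) -> forall i, c i = 0.
  move=> c0 i; have [|z zE] := @linear_pack _ V V (fun=> 0).
    by move=> a u v; rewrite scaler0 addr0.
  have [b [_ bU]] := eP z.
  have E0 : b = [ffun=> 0].
    by apply: bU => v; rewrite zE big1 // => j _; rewrite ffunE scale0r scale0r.
  have : b = finfun c.
    apply: bU => v; rewrite zE -[LHS](c0 v); apply: eq_bigr => j _.
    by rewrite ffunE.
  by rewrite E0 => /ffunP/(_ i); rewrite !ffunE => <-.
have [m [th [thZ thb]]] := kdim_bij (kdim_le_induced tP).
(* If V is zero, the uniqueness of coordinates leaves no room for a basis vector. *)
case: m th thZ thb => [|m] th thZ thb.
  rewrite leqNgt; apply/negP => d4.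
  have := e_free (fun=> 1) _ (Ordinal d4) => /=.
  move=> E; case/eqP: (oner_neq0 k); apply: E => v; apply: big1 => i _.
  have [thi _ thK] := thb.
  by rewrite -[e i v]thK (thinmx0 (thi _)) raddf0 scaler0.
have thI := bij_inj thb; have [thi thK thiK] := thb.
have /choice[X XE] i := endo_matrix (e i) thZ thb.
pose R := \matrix_(i < d) mxvec (X i).
have sumE (c : 'rV[k]_d) (v : 'rV_m.+1) :
    th (v *m vec_mx (c *m R)) = \sum_i (c 0 i)%:A *: e i (th v).
  rewrite [c *m R]mulmx_sum_row linear_sum mulmx_sumr raddf_sum.
  by apply: eq_bigr => i _; rewrite linearZ /= -scalemxAr thZ rowK mxvecK XE.
have rkR : \rank R = d.
  apply/eqP; rewrite -[_ == _]/(row_free R); apply/inj_row_free => c cR.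
  apply/rowP => i; rewrite mxE; apply: (e_free (fun i => c 0 i)) => v.
  by rewrite -[v]thiK -sumE cR linear0 mulmx0 raddf0.
have RP (Y : 'M_m.+1) : (Y \in R)%MS <->
    exists f : {linear V -> V}, forall v, th (v *m Y) = f (th v).
  split=> [/submxP[c cE]|[f fE]].
    have [|f fE] := @linear_pack _ V V (fun v => \sum_i (c 0 i)%:A *: e i v).
      move=> a u v; rewrite scaler_sumr -big_split; apply: eq_bigr => i _.
      by rewrite linearP /= scalerDr kscalC.
    by exists f => v; rewrite fE -sumE -cE mxvecK.
  have [b [bE _]] := eP f; apply/submxP; exists (\row_i b i).
  rewrite -[RHS]vec_mxK; congr mxvec; apply/row_matrixP => i; rewrite !rowE.
  apply: thI; rewrite fE sumE bE; apply: eq_bigr => j _; by rewrite mxE.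
have [I [Q [Qex Qeq]]] := fin 1 (kdim_le_induced tP).
pose w (f : {linear V -> V}) := fun i : 'I_2 => if i == ord0 then gen else f gen.
rewrite -rkR.
apply: (@mobius_finite_rank k m d R I (fun Y i => exists f : {linear V -> V},
  (forall v, th (v *m Y) = f (th v)) /\ Q (w f) i)).
- apply/RP; have [|f fE] := @linear_pack _ V V id; first by [].
  by exists f => v; rewrite mulmx1 fE.
- move=> Y Z /RP[f fE] /RP[g gE]; apply/RP.
  have [|h hE] := @linear_pack _ V V (g \o f); first by move=> a u v /=; rewrite !linearP.
  by exists h => v; rewrite mulmxA gE fE hE.
- move=> Y /RP[f fE]; have [|i Qi] := Qex (w f).
    move=> i; rewrite /w; case: ifP => _; [exact: (generator_fixed tP) | exact: hom_fixed].
  by exists i, f.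
move=> Y Z i [f [fE Qf]] [g [gE Qg]].
have [U [a [Ub UE]]] := Qeq _ _ _ Qf Qg.
have comb i0 : \sum_j (a i0 j)%:A *: w g j = (a i0 ord0)%:A *: gen + (a i0 (lift ord0 ord0))%:A *: g gen.
  by rewrite big_ord_recl big_ord_recl big_ord0 addr0.
have lin i0 : linear (fun v => (a i0 ord0)%:A *: v + (a i0 (lift ord0 ord0))%:A *: g v).
  by move=> b u v; rewrite linearP /= !scalerDr !kscalC addrACA.
have [l0 l0E] := linear_pack (lin ord0).
have [l1 l1E] := linear_pack (lin (lift ord0 ord0)).
have U0 : U =1 l0.
  by apply: eq_on_generator; rewrite l0E -comb -UE.
have [|Uf UfE] := @linear_pack _ V V (U \o f); first by move=> b u v /=; rewrite !linearP.
have U1 : Uf =1 l1.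
  by apply: eq_on_generator; rewrite l1E UfE -comb -UE.
exists (a ord0 ord0), (a ord0 (lift ord0 ord0)), (a (lift ord0 ord0) ord0),
  (a (lift ord0 ord0) (lift ord0 ord0)).
have lE i0 v : th (v *m ((a i0 ord0)%:M + a i0 (lift ord0 ord0) *: Z)) =
    (a i0 ord0)%:A *: th v + (a i0 (lift ord0 ord0))%:A *: g (th v).
  by rewrite mulmxDr raddfD mul_mx_scalar -scalemxAr !thZ gE.
split.
  rewrite -row_free_unit; apply/inj_row_free => v vE.
  have : U (th v) = U 0 by rewrite U0 l0E -lE vE raddf0 linear0.
  by move/(bij_inj Ub) => th0; apply: thI; rewrite th0 raddf0.
apply/row_matrixP => r; rewrite !rowE mulmxA; apply: thI.
by rewrite !lE fE -l0E -U0 -l1E -U1 UfE.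
Qed.

End Conclusions.

Theorem theorem1p3 (k : closedFieldType) (C : finEICat) (x y : C)
    (alpha : homset x y)
    (C_connected : connected_cat C) (C_skeletal : skeletal_cat C)
    (neq_xy : x != y) (ob_xy : forall z : C, z = x \/ z = y)
    (hom_yx : #|homset y x| = 0%N)
    (biorbit : single_biorbit x y)
    (transitive_H : ltransitive x y)
    (finite_kC : finite_representation_type (catalg k C))
    (V : lmodType (grpalg k (endgrp y)))
    (V_induced : induced_trivial (rorbit_stab_group alpha) V) :
  [/\ hom_dim V V #|double_cosets (rorbit_stab alpha)| /\
        (#|double_cosets (rorbit_stab alpha)| <= 3)%N,
      simple_summands_distinct (Top V)
    & forall M N : submodClosed V,
        direct_summand M -> direct_summand N ->
        indecomposable (submodule M) -> indecomposable (submodule N) ->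
        ~ isomorphic (submodule M) (submodule N) ->
        forall f : {linear submodule M -> submodule N}, forall m, f m = 0].
Proof.
have [t tP] := V_induced.
have fin : finitely_many_extensions k (rorbit_stab_group alpha).
  move=> W n D Wd.
  have [I [Q [Qex Qeq]]] :=
    extension_classification alpha neq_xy ob_xy hom_yx transitive_H n finite_kC Wd.
  by exists I, Q; split=> // w wf; apply: Qex => i h hH; apply: wf.
have dimV := hom_dim_induced tP; split.
- split; first exact: dimV.
  exact: (hom_dim_le3 fin tP dimV).
- exact: (top_summands_distinct fin tP).
- exact: (summand_hom0 fin tP).
Qed.
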